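(* Let $R$ be a right noetherian ring satisfying a polynomial identity. Then there exist a right noetherian, ideally commutative ring $T$ with (commutative) noetherian center $Z$, and a ring homomorphism $R\to T$, such that $$\theta\colon\operatorname{Spec}Z\to\operatorname{Spec}R,\qquad \theta(\mathfrak{q})=\operatorname{ann}\big((Z/\mathfrak{q})\otimes_Z T\big)_R,$$ is a well-defined, continuous, finite-to-one (all fibers finite) surjection, and such that, if $R$ and $Z$ are Jacobson rings, then $\theta$ restricts to a surjection from $\operatorname{Max}Z$ onto $\operatorname{Prim}R=\operatorname{Max}R$.
   Context: All rings are associative with identity. $\operatorname{Spec}$, $\operatorname{Prim}$, $\operatorname{Max}$ denote the sets of prime, right primitive, and maximal ideals, each with the Zariski/Jacobson topology (closed sets are the sets of such ideals containing a given subset). A Jacobson ring is a ring in which every prime ideal is an intersection of primitive ideals. A ring $\Lambda$ with center $Z(\Lambda)$ is ideally commutative if $\mathfrak{a}\mapsto\mathfrak{a}\cap Z(\Lambda)$ and $\mathfrak{b}\mapsto\mathfrak{b}\Lambda$ are mutually inverse, product preserving bijections between the ideals $\mathfrak{a}$ of $\Lambda$ and the ideals $\mathfrak{b}$ of $Z(\Lambda)$. Right $T$-modules are viewed as right $R$-modules via the homomorphism $R\to T$, and $\operatorname{ann}(M)_R$ is the annihilator in $R$ of the right $R$-module $M$. *)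

(* Defs.v *)
From HB Require Import structures.
From mathcomp Require Import all_boot all_algebra.
From mathcomp Require Import boolp classical_sets cardinality.
From mathcomp Require Import topology_structure.
From mathcomp Require Import finmap xfinmap monalg.

Set Implicit Arguments.
Unset Strict Implicit.
Unset Printing Implicit Defensive.

Import GRing.Theory.
Local Open Scope classical_set_scope.
Local Open Scope ring_scope.

(* Rings are [pzRingType]s (the zero ring is allowed).  A right R-module is a *)
(* left module over the converse ring R^c, that is, m r is (r : R^c) *: m.    *)

Section Ideals.
Variable R : pzRingType.
Implicit Types (I J P : set R).

Definition additive_subgroup (V : zmodType) (H : set V) :=
  H 0 /\ forall x y, H x -> H y -> H (x - y).

Definition right_ideal I :=
  additive_subgroup I /\ forall x r, I x -> I (x * r).

Definition ideal I :=
  additive_subgroup I /\ forall x r, I x -> I (r * x) /\ I (x * r).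

Definition ideal_mul I J : set R :=
  smallest (@additive_subgroup R) [set x * y | x in I & y in J].

Definition prime_ideal P :=
  [/\ ideal P, ~ P 1 &
      forall I J, ideal I -> ideal J ->
        ideal_mul I J `<=` P -> I `<=` P \/ J `<=` P].

Definition maximal_ideal P :=
  [/\ ideal P, ~ P 1 &
      forall J, ideal J -> P `<=` J -> J = P \/ J = setT].

Definition right_noetherian :=
  forall I : nat -> set R, (forall n, right_ideal (I n)) ->
    (forall n, I n `<=` I n.+1) ->
  exists n, forall m, (n <= m)%N -> I m = I n.

End Ideals.

Section Modules.
Variable K : pzRingType.

Definition submodule (M : lmodType K) (N : set M) :=
  additive_subgroup N /\ forall (a : K) x, N x -> N (a *: x).

Definition simple_module (M : lmodType K) :=
  (exists m : M, m <> 0) /\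
  forall N : set M, submodule N -> N = [set 0] \/ N = setT.

End Modules.

(* The annihilator in R of a right T-module, viewed as a right R-module via phi. *)
Definition ann_along (R T : pzRingType) (phi : R -> T) (M : lmodType T^c) :
    set R :=
  [set r | forall m : M, (phi r : T^c) *: m = 0].

Definition right_primitive (R : pzRingType) (P : set R) :=
  exists M : lmodType R^c, simple_module M /\ P = ann_along (@id R) M.

Definition Prim (R : pzRingType) : set (set R) := [set P | right_primitive P].
Definition Max (R : pzRingType) : set (set R) := [set P | maximal_ideal P].

Arguments Prim : clear implicits.
Arguments Max : clear implicits.

Definition jacobson (R : pzRingType) :=
  forall P : set R, prime_ideal P ->
  exists F : set (set R), F `<=` Prim R /\ P = \bigcap_(Q in F) Q.

Section IdealTheory.
Variable R : pzRingType.
Implicit Types (H I J P : set R).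

Lemma subgroupN (V : zmodType) (G : set V) x :
  additive_subgroup G -> G x -> G (- x).
Proof. by case=> G0 GB Gx; rewrite -sub0r; apply: GB. Qed.

Lemma subgroupD (V : zmodType) (G : set V) x y :
  additive_subgroup G -> G x -> G y -> G (x + y).
Proof.
by move=> Gg Gx Gy; rewrite -[y]opprK; apply: Gg.2 => //; apply: subgroupN.
Qed.

Lemma smallest_subgroup (V : zmodType) (S : set V) :
  additive_subgroup (smallest (@additive_subgroup V) S).
Proof.
split=> [G [[]] //|x y Gx Gy G [Gg SG]].
by apply: Gg.2; [apply: Gx | apply: Gy].
Qed.

Lemma smallest_ideal S : ideal (smallest (@ideal R) S).
Proof.
split; first split.
- by move=> J [[[]]].
- by move=> x y Gx Gy J JS; apply: JS.1.1.2; [apply: Gx | apply: Gy].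
by move=> x r Gx; split=> J JS; have [] := JS.1.2 x r (Gx J JS).
Qed.

Lemma ideal_mul_sub P I J : ideal P -> I `<=` P \/ J `<=` P ->
  ideal_mul I J `<=` P.
Proof.
move=> Pi IJP x; apply; split; first exact: Pi.1.
move=> _ [a Ia [b Jb <-]].
by case: IJP => [IP|JP]; [have [] := Pi.2 a b (IP _ Ia)
                         |have [] := Pi.2 b a (JP _ Jb)].
Qed.

Lemma ideal_addP I J : ideal I -> ideal J ->
  ideal [set x + y | x in I & y in J].
Proof.
move=> Ii Ji; split; first split.
- exists 0; first exact: Ii.1.1.
  by exists 0; [exact: Ji.1.1 | rewrite addr0].
- move=> _ _ [a Ia [b Jb <-]] [c Ic [d Jd <-]].
  exists (a - c); first exact: Ii.1.2.
  exists (b - d); first exact: Ji.1.2.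
  by rewrite opprD addrACA.
move=> _ r [a Ia [b Jb <-]].
have [Ia1 Ia2] := Ii.2 a r Ia; have [Jb1 Jb2] := Ji.2 b r Jb.
split; [exists (r * a) => //; exists (r * b) => //; by rewrite mulrDr|].
by exists (a * r) => //; exists (b * r) => //; rewrite mulrDl.
Qed.

Lemma maximal_prime P : maximal_ideal P -> prime_ideal P.
Proof.
case=> Pi P1 Pmax; split=> // I J Ii Ji IJP.
have key L : ideal L -> ~ L `<=` P ->
    exists x y, [/\ L x, P y & x + y = 1].
  move=> Li LP; have Si := ideal_addP Li Pi.
  have [] := Pmax _ Si.
  - by move=> y Py; exists 0; [exact: Li.1.1 | exists y; rewrite ?add0r].
  - move=> SP; case: LP => x Lx; rewrite -SP.
    by exists x => //; exists 0; [exact: Pi.1.1 | rewrite addr0].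
  - move=> ST; have : [set: R] 1 by [].
    by rewrite -ST => -[x Lx [y Py <-]]; exists x, y.
apply: contrapT => /not_orP[/(key _ Ii)[x [y [Ix Py xy]]]].
move=> /(key _ Ji)[z [t [Jz Pt zt]]]; apply: P1.
rewrite -[1]mulr1 -{1}xy -zt mulrDl; apply: subgroupD (Pi.1) _ _; last first.
  by have [] := Pi.2 y (z + t) Py.
rewrite mulrDr; apply: subgroupD (Pi.1) _ _; last by have [] := Pi.2 t x Pt.
by apply: IJP => G [_]; apply; exists x => //; exists z.
Qed.

End IdealTheory.

Section Spectrum.
Variable R : pzRingType.

Record spec := Spec { spec_ideal :> set R; spec_prime : prime_ideal spec_ideal }.

HB.instance Definition _ := gen_eqMixin spec.
HB.instance Definition _ := gen_choiceMixin spec.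

Definition zariski_closed (S : set R) : set spec := [set P | S `<=` spec_ideal P].

Definition zariski_open : set (set spec) :=
  [set U | exists S : set R, U = ~` zariski_closed S].

Lemma zariski_openT : zariski_open setT.
Proof.
exists [set 1]; apply/seteqP; split=> // P _ /(_ 1 erefl).
by have [] := spec_prime P.
Qed.

Lemma zariski_openI : setI_closed zariski_open.
Proof.
move=> _ _ [S ->] [S' ->].
pose g X := smallest (@ideal R) X.
exists (ideal_mul (g S) (g S')); rewrite -setCU; congr (~` _).
have gE (P : spec) X : X `<=` P <-> g X `<=` P.
  have [Pi _ _] := spec_prime P; split=> [XP x|gP x Xx].
    by apply; split.
  by apply: gP => J [_]; apply.
apply/seteqP; split=> [P SP|P SSP].
  apply: ideal_mul_sub; first by have [] := spec_prime P.
  by case: SP => /gE; [left | right].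
have [_ _ Pp] := spec_prime P.
have := Pp _ _ (@smallest_ideal _ S) (@smallest_ideal _ S') SSP.
by case=> /(gE P _).2; [left | right].
Qed.

Lemma zariski_open_bigU (I : Type) (f : I -> set spec) :
  (forall i, zariski_open (f i)) -> zariski_open (\bigcup_i f i).
Proof.
move=> /choice[S fE]; exists (\bigcup_i S i).
apply/seteqP; split=> [P [i _]|P].
  by rewrite fE => SP SU; apply: SP => x Sx; apply: SU; exists i.
move=> SP; apply: contrapT => nU; apply: SP => x [i _ Sx].
apply: contrapT => Px; apply: nU; exists i => //; rewrite fE => SP.
exact/Px/SP.
Qed.

HB.instance Definition _ := isOpenTopological.Build spec
  zariski_openT zariski_openI zariski_open_bigU.

Lemma closed_specP (A : set spec) :
  closed A <-> exists S, A = zariski_closed S.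
Proof.
rewrite -openC; split=> [[S]|[S ->]]; last by exists S.
by move=> AE; exists S; rewrite -[A]setCK AE setCK.
Qed.

End Spectrum.

(* R satisfies a monic f in Z<x_0, x_1, ...>: some monomial of highest degree *)
(* in the support of f has coefficient 1.                                     *)
Definition free_eval (R : pzRingType) (x : nat -> R)
    (f : {malg int[{fmonom nat}]}) : R :=
  \sum_(m <- msupp f) (\prod_(i <- fmonom_val m) x i) *~ (f@_m).

Definition free_monic (f : {malg int[{fmonom nat}]}) :=
  exists m : {fmonom nat}, f@_m = 1 /\
    forall m', m' \in msupp f -> (fdeg m' <= fdeg m)%N.

Definition PI_ring (R : pzRingType) :=
  exists f : {malg int[{fmonom nat}]},
    free_monic f /\ forall x : nat -> R, free_eval x f = 0.

Section Center.
Variable R : pzRingType.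

Definition central : {pred R} := [pred z | `[< forall x : R, z * x = x * z >]].

Lemma centralP z : reflect (forall x : R, z * x = x * z) (z \in central).
Proof. exact: asboolP. Qed.

Lemma central_subring : subring_closed central.
Proof.
split; first by apply/centralP => x; rewrite mul1r mulr1.
  move=> a b /centralP aZ /centralP bZ; apply/centralP => x.
  by rewrite mulrBl mulrBr aZ bZ.
move=> a b /centralP aZ /centralP bZ; apply/centralP => x.
by rewrite -mulrA bZ mulrA aZ -mulrA.
Qed.
HB.instance Definition _ := GRing.isSubringClosed.Build R central central_subring.

Record center := Center { center_val :> R; _ : center_val \in central }.
HB.instance Definition _ := [isSub for center_val].
HB.instance Definition _ := [Choice of center by <:].
HB.instance Definition _ :=
  GRing.SubChoice_isSubPzRing.Build R central center central_subring.

Lemma center_mulC : commutative (@GRing.mul center).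
Proof.
by move=> x y; apply: val_inj; rewrite !rmorphM; apply/centralP/(valP x).
Qed.
HB.instance Definition _ := GRing.PzRing_hasCommutativeMul.Build center center_mulC.

End Center.

Section IdeallyCommutative.
Variable R : pzRingType.

Definition contraction (I : set R) : set (center R) :=
  [set z | I (center_val z)].

Definition extension (J : set (center R)) : set R :=
  smallest (@additive_subgroup R) [set center_val z * x | z in J & x in setT].

Definition ideally_commutative :=
  [/\ forall I, ideal I -> extension (contraction I) = I,
      forall J, ideal J -> contraction (extension J) = J,
      forall I I', ideal I -> ideal I' ->
        contraction (ideal_mul I I') =
        ideal_mul (contraction I) (contraction I')
    & forall J J', ideal J -> ideal J' ->
        extension (ideal_mul J J') =
        ideal_mul (extension J) (extension J')].

End IdeallyCommutative.

Section QuotientGroup.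
Variables (V : zmodType) (H : set V) (Hsub : additive_subgroup H).

Definition subgroup_pred of additive_subgroup H : {pred V} :=
  [pred x | `[< H x >]].

Lemma subgroup_pred_zmod : zmod_closed (subgroup_pred Hsub).
Proof.
split=> [|x y]; rewrite !inE; first exact/asboolP/Hsub.1.
by move=> /asboolP Hx /asboolP Hy; apply/asboolP/Hsub.2.
Qed.
HB.instance Definition _ :=
  GRing.isZmodClosed.Build V (subgroup_pred Hsub) subgroup_pred_zmod.

Definition quot_group := Quotient.quot (subgroup_pred Hsub).
HB.instance Definition _ := GRing.Zmodule.on quot_group.

Definition quot_proj (x : V) : quot_group :=
  (\pi_(Quotient.quot (subgroup_pred Hsub)) x)%qT.

Lemma quot_proj_eq x y : quot_proj x = quot_proj y <-> H (x - y).
Proof.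
split=> [/eqP|Hxy]; last apply/eqP.
  by rewrite -Quotient.idealrBE inE => /asboolP.
by rewrite -Quotient.idealrBE inE; apply/asboolP.
Qed.

Lemma quot_proj_surj (u : quot_group) : exists x, quot_proj x = u.
Proof. by exists (repr u); rewrite /quot_proj reprK. Qed.

Lemma quot_proj_is_zmod_morphism : zmod_morphism quot_proj.
Proof. by move=> x y; rewrite /quot_proj /= !piE. Qed.
HB.instance Definition _ :=
  GRing.isZmodMorphism.Build V quot_group quot_proj quot_proj_is_zmod_morphism.

End QuotientGroup.

Section QuotientModule.
Variables (K : pzRingType) (M : lmodType K) (N : set M) (Nsub : submodule N).

Definition quot_module := quot_group Nsub.1.
HB.instance Definition _ := GRing.Zmodule.on quot_module.

Definition quot_scale (a : K) (u : quot_module) : quot_module :=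
  quot_proj Nsub.1 (a *: repr u).

Lemma quot_scaleE a x :
  quot_scale a (quot_proj Nsub.1 x) = quot_proj Nsub.1 (a *: x).
Proof.
apply/quot_proj_eq; rewrite -scalerBr; apply: Nsub.2.
by apply/(quot_proj_eq Nsub.1); rewrite {1}/quot_proj reprK.
Qed.

Lemma quot_scaleA a b u :
  quot_scale a (quot_scale b u) = quot_scale (a * b) u.
Proof.
by have [x <-] := quot_proj_surj u; rewrite !quot_scaleE scalerA.
Qed.

Lemma quot_scale1 : left_id 1 quot_scale.
Proof.
by move=> u; have [x <-] := quot_proj_surj u; rewrite quot_scaleE scale1r.
Qed.

Lemma quot_scaleDr : right_distributive quot_scale +%R.
Proof.
move=> a u v; have [x <-] := quot_proj_surj u.
have [y <-] := quot_proj_surj v.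
by rewrite -raddfD !quot_scaleE scalerDr raddfD.
Qed.

Lemma quot_scaleDl u : {morph quot_scale^~ u : a b / a + b}.
Proof.
by move=> a b; have [x <-] := quot_proj_surj u;
  rewrite !quot_scaleE scalerDl raddfD.
Qed.

HB.instance Definition _ := GRing.Zmodule_isLmodule.Build K quot_module
  quot_scaleA quot_scale1 quot_scaleDr quot_scaleDl.

End QuotientModule.

Section TensorProduct.
Variables (K : comPzRingType) (A B : lmodType K).

Local Notation free := {malg int[(A * B)%type]}.
Local Notation gen a b := (<< (a : A, b : B) >> : free).

Inductive tensor_relator : set free :=
| TensorDl a a' b : tensor_relator (gen (a + a') b - gen a b - gen a' b)
| TensorDr a b b' : tensor_relator (gen a (b + b') - gen a b - gen a b')
| TensorZ (k : K) a b : tensor_relator (gen (k *: a) b - gen a (k *: b)).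

Definition tensor :=
  quot_group (smallest_subgroup tensor_relator).
HB.instance Definition _ := GRing.Zmodule.on tensor.

Definition tens (a : A) (b : B) : tensor :=
  quot_proj (smallest_subgroup tensor_relator) (gen a b).

Lemma tensor_relator0 x : tensor_relator x ->
  quot_proj (smallest_subgroup tensor_relator) x = 0.
Proof.
move=> rx; rewrite -(raddf0 (quot_proj (smallest_subgroup tensor_relator))).
by apply/quot_proj_eq; rewrite subr0 => G [_]; apply.
Qed.

Lemma tensDl a a' b : tens (a + a') b = tens a b + tens a' b.
Proof.
have := tensor_relator0 (TensorDl a a' b).
by rewrite !raddfB /= => /eqP; rewrite -addrA -opprD subr_eq0 => /eqP.
Qed.

Lemma tensDr a b b' : tens a (b + b') = tens a b + tens a b'.
Proof.
have := tensor_relator0 (TensorDr a b b').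
by rewrite !raddfB /= => /eqP; rewrite -addrA -opprD subr_eq0 => /eqP.
Qed.

Lemma tensZ k a b : tens (k *: a) b = tens a (k *: b).
Proof.
have := tensor_relator0 (TensorZ k a b).
by rewrite !raddfB /= => /eqP; rewrite subr_eq0 => /eqP.
Qed.

Lemma malg_ind (P : free -> Prop) :
  P 0 -> (forall x y, P x -> P y -> P (x - y)) -> (forall a b, P (gen a b)) ->
  forall x, P x.
Proof.
move=> P0 PB Pg x.
have PN y : P y -> P (- y) by move=> Py; rewrite -sub0r; apply: PB.
have PD y z : P y -> P z -> P (y + z).
  by move=> Py Pz; rewrite -[z]opprK; apply: PB => //; apply: PN.
rewrite [x]monalgE; elim/big_ind: _ => // -[a b] _.
have PU n : P << n%:Z *g (a, b) >>.
  by elim: n => [|n IH]; rewrite ?monalgU0 // intS monalgUD; apply: PD.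
by case: (x@_(a, b)) => n //; rewrite NegzE monalgUN; apply: PN.
Qed.

Lemma tensor_ind (P : tensor -> Prop) :
  P 0 -> (forall u v, P u -> P v -> P (u - v)) -> (forall a b, P (tens a b)) ->
  forall u, P u.
Proof.
move=> P0 PB Pt u; have [x <-] := quot_proj_surj u.
elim/malg_ind: x => [|x y Px Py|a b]; last exact: Pt.
  by rewrite raddf0.
by rewrite raddfB; apply: PB.
Qed.

End TensorProduct.

Section TensorLift.
Variables (K : comPzRingType) (A B : lmodType K) (V : zmodType).
Variable f : A -> B -> V.
Hypotheses (fDl : forall a a' b, f (a + a') b = f a b + f a' b)
           (fDr : forall a b b', f a (b + b') = f a b + f a b')
           (fZ : forall k a b, f (k *: a) b = f a (k *: b)).

Definition free_lift (x : {malg int[(A * B)%type]}) : V :=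
  \sum_(k <- msupp x) f k.1 k.2 *~ x@_k.

Lemma free_liftEw (d : {fset (A * B)%type}) x : (msupp x `<=` d)%fset ->
  free_lift x = \sum_(k <- d) f k.1 k.2 *~ x@_k.
Proof.
move=> le; rewrite [LHS](big_fset_incl _ le) // => k kd /mcoeff_outdom ->.
by rewrite mulr0z.
Qed.

Lemma free_lift_is_zmod_morphism : zmod_morphism free_lift.
Proof.
move=> x y; pose d := (msupp x `|` msupp y `|` msupp (x - y))%fset.
have [dx dy dxy] : [/\ (msupp x `<=` d)%fset, (msupp y `<=` d)%fset &
    (msupp (x - y) `<=` d)%fset].
  by split; apply/fsubsetP => k; rewrite /d !inE => ->; rewrite ?orbT.
rewrite (free_liftEw dx) (free_liftEw dy) (free_liftEw dxy).
by rewrite -sumrB; apply: eq_bigr => k _; rewrite raddfB /= mulrzBr.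
Qed.
HB.instance Definition _ :=
  GRing.isZmodMorphism.Build _ _ free_lift free_lift_is_zmod_morphism.

Lemma free_liftU a b : free_lift << (a, b) >> = f a b.
Proof.
by rewrite (@free_liftEw [fset (a, b)]%fset) ?msuppU_le //
  big_seq_fset1 mcoeffUU.
Qed.

Definition tensor_lift (u : tensor A B) : V := free_lift (repr u).

Lemma tensor_liftE x :
  tensor_lift (quot_proj (smallest_subgroup (@tensor_relator K A B)) x) =
  free_lift x.
Proof.
have key y : smallest (@additive_subgroup _) (@tensor_relator K A B) y ->
    free_lift y = 0.
  move=> sy; apply: (sy [set z | free_lift z = 0]).
  split=> [|z [a a' b|a b b'|k a b]] /=.
  - split=> [|z t]; first exact: raddf0.
    by move=> /= z0 t0; rewrite raddfB /= z0 t0 subr0.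
  - by rewrite !raddfB /= !free_liftU fDl addrAC addrK subrr.
  - by rewrite !raddfB /= !free_liftU fDr addrAC addrK subrr.
  - by rewrite !raddfB /= !free_liftU fZ subrr.
apply/eqP; rewrite -subr_eq0 -raddfB /=; apply/eqP/key.
apply/(quot_proj_eq (smallest_subgroup (@tensor_relator K A B))).
by rewrite {1}/quot_proj reprK.
Qed.

Lemma tensor_lift_is_zmod_morphism : zmod_morphism tensor_lift.
Proof.
move=> u v; have [x <-] := quot_proj_surj u; have [y <-] := quot_proj_surj v.
by rewrite -raddfB !tensor_liftE raddfB.
Qed.

Lemma tensor_lift_tens a b : tensor_lift (tens a b) = f a b.
Proof. by rewrite tensor_liftE free_liftU. Qed.

End TensorLift.

Section CenterModule.
Variable T : pzRingType.

(* T as a module over its center. *)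
Definition center_module : Type := T.
HB.instance Definition _ := GRing.Zmodule.on center_module.

Fact center_module_scaleA (y z : center T) (t : center_module) :
  center_val y * (center_val z * t) = center_val (y * z) * t.
Proof. by rewrite mulrA. Qed.
Fact center_module_scale1 :
  left_id (1 : center T) (fun z (t : center_module) => center_val z * t).
Proof. by move=> t; rewrite mul1r. Qed.
Fact center_module_scaleDr :
  right_distributive (fun (z : center T) (t : center_module) =>
    center_val z * t : center_module) +%R.
Proof. by move=> z t t'; rewrite mulrDr. Qed.
Fact center_module_scaleDl (t : center_module) :
  {morph (fun z : center T => center_val z * t : center_module) :
    y z / y + z}.
Proof. by move=> y z; rewrite -mulrDl. Qed.
HB.instance Definition _ := GRing.Zmodule_isLmodule.Build (center T)
  center_module center_module_scaleA center_module_scale1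
  center_module_scaleDr center_module_scaleDl.

Variable A : lmodType (center T).

(* The right T-module A (x)_Z T, with (a (x) b) t = a (x) (b t). *)
Definition base_change := tensor A center_module.
HB.instance Definition _ := GRing.Zmodule.on base_change.

Definition tens_mulr (t : T) (a : A) (b : center_module) : base_change :=
  tens a ((b : T) * t : center_module).

Definition base_change_scale (t : T^c) : base_change -> base_change :=
  tensor_lift (tens_mulr t).

Lemma tens_mulrDl t a a' b :
  tens_mulr t (a + a') b = tens_mulr t a b + tens_mulr t a' b.
Proof. exact: tensDl. Qed.

Lemma tens_mulrDr t a b b' :
  tens_mulr t a (b + b') = tens_mulr t a b + tens_mulr t a b'.
Proof. by rewrite /tens_mulr mulrDl tensDr. Qed.

Lemma tens_mulrZ t z a b : tens_mulr t (z *: a) b = tens_mulr t a (z *: b).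
Proof. by rewrite /tens_mulr tensZ /GRing.scale /= mulrA. Qed.

Lemma base_change_scale_tens (t : T) (a : A) (b : T) :
  base_change_scale t (tens a (b : center_module)) =
  tens a (b * t : center_module).
Proof.
apply: tensor_lift_tens; [exact: tens_mulrDl|exact: tens_mulrDr|].
exact: tens_mulrZ.
Qed.

Lemma base_change_scale_is_zmod_morphism t :
  zmod_morphism (base_change_scale t).
Proof.
apply: tensor_lift_is_zmod_morphism; [exact: tens_mulrDl|exact: tens_mulrDr|].
exact: tens_mulrZ.
Qed.
HB.instance Definition _ t := GRing.isZmodMorphism.Build _ _
  (base_change_scale t) (base_change_scale_is_zmod_morphism t).

Lemma base_change_scaleA (s t : T^c) u :
  base_change_scale s (base_change_scale t u) = base_change_scale (s * t) u.
Proof.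
elim/tensor_ind: u => [|u v IHu IHv|a b]; first by rewrite !raddf0.
  by rewrite !raddfB /= IHu IHv.
by rewrite !base_change_scale_tens -mulrA.
Qed.

Lemma base_change_scale1 : left_id 1 base_change_scale.
Proof.
elim/tensor_ind => [|u v IHu IHv|a b]; first by rewrite raddf0.
  by rewrite raddfB /= IHu IHv.
by rewrite base_change_scale_tens mulr1.
Qed.

Lemma base_change_scaleDr : right_distributive base_change_scale +%R.
Proof. by move=> t u v; rewrite raddfD. Qed.

Lemma base_change_scaleDl u : {morph base_change_scale^~ u : s t / s + t}.
Proof.
move=> s t; elim/tensor_ind: u => [|u v IHu IHv|a b].
- by rewrite !raddf0 addr0.
- by rewrite !raddfB /= IHu IHv opprD addrACA.
by rewrite !base_change_scale_tens mulrDr tensDr.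
Qed.

HB.instance Definition _ := GRing.Zmodule_isLmodule.Build T^c base_change
  base_change_scaleA base_change_scale1
  base_change_scaleDr base_change_scaleDl.

End CenterModule.

(* The Z-module Z/q. *)
Section ResidueModule.
Variables (K : comPzRingType) (q : spec K).

Lemma spec_submodule : submodule (spec_ideal q : set K^o).
Proof.
have [[qs qM] _ _] := spec_prime q; split=> // a x qx.
by have [] := qM x a qx.
Qed.

Definition residue_module : lmodType K := quot_module spec_submodule.

End ResidueModule.

(* Main.v *)
(* Noetherian induction on closed sets of primes reduces the theorem to a prime
   ideal P: if some central c <> 0 of R / P makes (R / P)[1 / c] Azumaya, then the
   primes of that localization are the primes of R over P that avoid c, and the
   remaining primes are those over P + RcR.  T is the product of the finitely
   many localizations, whose ideals are generated by central elements.

   For a prime right noetherian PI ring R, work with the operators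
   x |-> sum u_k x v_k.  If none of them had finite rank over the extended
   centroid, the terms of a multilinear identity in which one variable precedes
   another would vanish separately, and finally the single monomial x_1 ... x_d.
   So there is a rank-one operator; it gives w, u <> 0 with w R u of finite
   dimension, and since RwR is finitely generated on the right, R acts
   faithfully on the finite-dimensional left ideal RwRu.  Hence R itself has
   finite dimension.  Adjoint operators (u_k and v_k exchanged) then produce
   nonzero multiples of the trace that take values in the center of R, and
   dual bases for them up to a central denominator c.  Primitive ideals are
   maximal because over such c a simple module is finitely generated over the
   center, so Nakayama's lemma applies. *)
From HB Require Import structures.
Require Import Defs.
From mathcomp Require Import all_boot all_algebra zify.
From mathcomp Require Import boolp classical_sets cardinality.
From mathcomp Require Import topology_structure.
From mathcomp Require Import finmap xfinmap monalg.

Set Implicit Arguments.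
Unset Strict Implicit.
Unset Printing Implicit Defensive.

Import GRing.Theory.
Local Open Scope classical_set_scope.
Local Open Scope ring_scope.

(** * Coordinates without the extended centroid *)

(** The extended centroid is never constructed. A scalar multiple of [w] is recognized inside [R] as
    an element [th] with [th * x * w = w * x * th] for all [x]. Linear algebra is done with such
    denominators, and primeness removes them: if [w * y * b = 0] for all [y], with [w != 0], then
    [b = 0]. Operators [x |-> sum u_k x v_k] take the place of linear forms in testing independence
    and span.

    The trace must be usable in every characteristic. On a central simple algebra of degree n, left
    multiplication by z has trace n trd(z), which is identically zero if the characteristic divides
    n. The operator x |-> z x y has trace trd(z) trd(y), which is not identically zero; hence the
    two-sided multiplications throughout.

    The Azumaya property is carried as explicit dual bases, so that lifting them from a quotient,
    inverting a central element and forming products are computations with the same elements. *)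

Definition prime_ring (R : pzRingType) :=
  (1 : R) != 0 /\
  forall a b : R, (forall y, a * y * b = 0) -> a = 0 \/ b = 0.

Lemma prime_ringP (R : pzRingType) (a b : R) : prime_ring R ->
  a != 0 -> b != 0 -> exists y, a * y * b != 0.
Proof.
move=> [_ pR] a0 b0; apply: contrapT => nex.
have [y||] := pR a b; last 2 first.
- by move/eqP; rewrite (negbTE a0).
- by move/eqP; rewrite (negbTE b0).
by apply: contrapT => /eqP ab; apply: nex; exists y.
Qed.

Lemma prime_lcancel (R : pzRingType) (w b : R) : prime_ring R -> w != 0 ->
  (forall y, w * y * b = 0) -> b = 0.
Proof. by move=> [_ pR] w0 /pR[/eqP|//]; rewrite (negbTE w0). Qed.

Lemma prime_rcancel (R : pzRingType) (w b : R) : prime_ring R -> w != 0 ->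
  (forall y, b * y * w = 0) -> b = 0.
Proof. by move=> [_ pR] w0 /pR[//|/eqP]; rewrite (negbTE w0). Qed.

Section DualSystems.
Variables (R : pzRingType) (X : Type) (Op : set (X -> R)).
Hypothesis pR : prime_ring R.
Hypothesis OpB : forall T U, Op T -> Op U -> Op (fun x => T x - U x).
Hypothesis OpMl : forall u T, Op T -> Op (fun x => u * T x).
Hypothesis OpMr : forall v T, Op T -> Op (fun x => T x * v).

(* For a simple ring with center [C], [E i x = xi_i(x) w] where [xi_i(x)] is the
   [i]-th coordinate of [x] over [C] in the independent family [a]; the factor
   [w] is a denominator that keeps everything inside [R]. *)
Definition dual_system n (a : nat -> X) (E : nat -> X -> R) (w : R) :=
  [/\ w != 0, forall i, (i < n)%N -> Op (E i) &
      forall i j, (i < n)%N -> (j < n)%N ->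
        E i (a j) = if i == j then w else 0].

(** Containment of [Y] in the span of the [a i], expressed by annihilators in [Op]. [X] and [Op]
    stay abstract because the results are applied both to [R] and to vectors over [R]. *)
Definition spans n (a : nat -> X) (Y : set X) :=
  forall T, Op T -> (forall i, (i < n)%N -> T (a i) = 0) ->
  forall x, Y x -> T x = 0.

(** Cross-multiplication replaces division: each old [E i] is corrected by a multiple of [T] so as
    to vanish at [b], and primeness supplies the [y] that keeps the new denominator [w * y * T b]
    nonzero. *)
Lemma dual_system_extend n a E w b T : dual_system n a E w -> Op T ->
  (forall i, (i < n)%N -> T (a i) = 0) -> T b != 0 ->
  exists E' w', dual_system n.+1 (fun i => if i == n then b else a i) E' w'.
Proof.
move=> [w0 EO Ea] OT Ta Tb; have [y wyT] := prime_ringP pR w0 Tb.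
exists (fun i => if i == n then fun x => w * y * T x
          else fun x => E i x * (y * T b) - E i b * y * T x), (w * y * T b).
split=> // [i|i j].
  rewrite ltnS leq_eqVlt; case: eqVneq => [_ _|_ /= lin]; first exact: OpMl.
  by apply: OpB; [apply/OpMr/EO | apply: OpMl].
have ltSE k : (k < n.+1)%N = (k == n) || (k < n)%N by rewrite ltnS leq_eqVlt.
rewrite !ltSE.
case: (eqVneq i n) => [->|in_] /= lin; case: (eqVneq j n) => [->|jn] /= ljn.
- by rewrite ?eqxx.
- by rewrite Ta // mulr0.
- by rewrite (negbTE in_) mulrA subrr.
- rewrite Ea // Ta // mulr0 subr0; case: eqP => _; last by rewrite mul0r.
  by rewrite mulrA.
Qed.

(** Steinitz exchange. The set [Z] collects the [d l] already used; that the [E i] vanish on it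
    stands for passing to a quotient by their span. Either some [E i0] is nonzero at [d L] and
    corrects the others, at the cost of one index, or all of them already vanish there. *)
Lemma steinitz L : forall (d : nat -> X) n a E w (Z : set X),
  dual_system n a E w ->
  (forall i, (i < n)%N -> forall x, Z x -> E i x = 0) ->
  (forall T, Op T -> (forall x, Z x -> T x = 0) ->
    (forall l, (l < L)%N -> T (d l) = 0) ->
    forall i, (i < n)%N -> T (a i) = 0) ->
  (n <= L)%N.
Proof.
elim: L => [|L IH] d n a E w Z [w0 EO Ea] EZ span.
  case: n => // n in EO Ea EZ span *.
  (* With no [d l] left, [span] applies to [E 0] itself and would make [E 0 (a 0) = w] vanish. *)
  have := span (E 0%N) (EO 0%N isT) (EZ 0%N isT) (fun _ => fun F => match notF F with end) 0%N isT.
  by rewrite Ea //= => /eqP; rewrite (negbTE w0).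
have [[i0 [i0n Eid]]|nE] := pselect (exists i, (i < n)%N /\ E i (d L) != 0).
  case: n i0n => // n i0n in EO Ea EZ span *.
  have [y wyE] := prime_ringP pR w0 Eid.
  have bn i : (i < n)%N -> (bump i0 i < n.+1)%N.
    by move=> lin; rewrite ltnS /bump; case: (i0 <= i)%N; rewrite ?add1n ?add0n // ltnW.
  have bi i : (i0 == bump i0 i) = false by apply/negbTE; rewrite neq_bump.
  rewrite ltnS.
  apply: (IH d n (fun i => a (bump i0 i))
    (fun i x => E (bump i0 i) x * (y * E i0 (d L)) -
                E (bump i0 i) (d L) * y * E i0 x) (w * y * E i0 (d L))
    (Z `|` [set d L])).
  - split=> // [i lin|i j lin ljn].
      by apply: OpB; [apply/OpMr/EO/bn | apply/OpMl/EO].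
    rewrite !Ea ?bn // bi mulr0 subr0 (inj_eq (can_inj (bumpK i0))).
    by case: eqP => _; rewrite ?mul0r ?mulrA.
  - move=> i lin x [Zx|->]; last by rewrite mulrA subrr.
    by rewrite (EZ _ (bn _ lin) _ Zx) (EZ _ i0n _ Zx) mul0r mulr0 subr0.
  - move=> T OT TZ Td i lin; apply: (span T OT); [by move=> x Zx; apply: TZ; left| |exact: bn].
    move=> l; rewrite ltnS leq_eqVlt => /predU1P[->|/Td//].
    by apply: TZ; right.
apply: leqW; apply: (IH d n a E w (Z `|` [set d L])) => //.
  move=> i lin x [Zx|->]; first exact: EZ.
  by apply: contrapT => /eqP Ed; apply: nE; exists i.
move=> T OT TZ Td i lin; apply: (span T OT) => //.
  by move=> x Zx; apply: TZ; left.
move=> l; rewrite ltnS leq_eqVlt => /predU1P[->|/Td//].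
by apply: TZ; right.
Qed.

Lemma dual_system_le_spans n a E w L d Y : dual_system n a E w ->
  (forall i, (i < n)%N -> Y (a i)) -> spans L d Y -> (n <= L)%N.
Proof.
move=> sys aY sp; apply: (@steinitz L d n a E w set0) => // T OT _ Td i lin.
by apply: (sp T OT Td); apply: aY.
Qed.

(** A system of maximal size spans, since an operator refuting this would extend it. *)
Lemma max_dual_system N (x0 : X) (Y : set X) :
  (forall n a E w, dual_system n a E w ->
    (forall i, (i < n)%N -> Y (a i)) -> (n <= N)%N) ->
  exists n a E w, [/\ dual_system n a E w,
    forall i, (i < n)%N -> Y (a i) & spans n a Y].
Proof.
move=> bnd.
pose P n := `[< exists a E w, dual_system n a E w /\
                  forall i, (i < n)%N -> Y (a i) >].
have P0 : exists n, P n.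
  exists 0%N; apply/asboolP; exists (fun=> x0), (fun _ _ => 0), 1.
  by split=> //; split=> //; case: pR.
have PN n : P n -> (n <= N)%N by move=> /asboolP[a [E [w [/bnd]]]]; apply.
case: (ex_maxnP P0 PN) => n /asboolP[a [E [w [sys aY]]]] nmax.
exists n, a, E, w; split=> // T OT Ta x Yx; apply: contrapT => /eqP Tx.
have [E' [w' sys']] := dual_system_extend sys OT Ta Tx.
have /nmax : P n.+1; last by rewrite ltnn.
apply/asboolP; exists (fun i => if i == n then x else a i), E', w'; split=> // i.
by rewrite ltnS leq_eqVlt; case: eqVneq => //= _; apply: aY.
Qed.

Lemma finite_basis L (d : nat -> X) :
  exists n a E w, [/\ dual_system n a E w,
    forall i, (i < n)%N -> exists2 l, (l < L)%N & d l = a i &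
    spans n a [set x | exists2 l, (l < L)%N & d l = x]].
Proof.
apply: (@max_dual_system L (d 0%N)) => n a E w sys aY.
by apply: (dual_system_le_spans sys aY (d := d)) => T OT Td _ [l lL <-]; apply: Td.
Qed.

End DualSystems.

(** * Multiplication operators *)

Section MultiplicationOperators.
Variable R : pzRingType.
Implicit Types (f g : R -> R) (s : seq (R * R)).

Definition mulop s (x : R) := \sum_(p <- s) p.1 * x * p.2.

Definition flip s := [seq (p.2, p.1) | p <- s].

(** A relation and not a map, because an operator has many coefficient lists; that the choice of
    list is immaterial is the content of [flip0]. In a central simple algebra this is adjunction for
    the trace form, as tr(u x v y) = tr(x v y u). *)
Definition adjoint f g := exists s, f = mulop s /\ g = mulop (flip s).

Definition is_mulop : set (R -> R) := [set f | exists s, f = mulop s].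

Lemma mulop_flip s x : mulop (flip s) x = \sum_(p <- s) p.2 * x * p.1.
Proof. by rewrite /mulop big_map. Qed.

Lemma flipK : involutive flip.
Proof. by elim=> //= -[u v] s ->. Qed.

Lemma adjoint_sym f g : adjoint f g -> adjoint g f.
Proof. by case=> s [-> ->]; exists (flip s); rewrite flipK. Qed.

Lemma adjoint_mulop f g : adjoint f g -> is_mulop f.
Proof. by case=> s [-> _]; exists s. Qed.

Lemma mulop_adjoint f : is_mulop f -> exists g, adjoint f g.
Proof. by case=> s ->; exists (mulop (flip s)), s. Qed.

Lemma adjoint0 : adjoint (fun=> 0) (fun=> 0).
Proof. by exists [::]; split; apply/funext=> x; rewrite /mulop big_nil. Qed.

Lemma adjoint_id : adjoint id id.
Proof.
by exists [:: (1, 1)]; split; apply/funext=> x;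
  rewrite /mulop big_seq1 mul1r mulr1.
Qed.

Lemma adjointD f g f' g' : adjoint f g -> adjoint f' g' ->
  adjoint (fun x => f x + f' x) (fun x => g x + g' x).
Proof.
move=> [s [-> ->]] [t [-> ->]]; exists (s ++ t); split; apply/funext=> x.
  by rewrite /mulop big_cat.
by rewrite /mulop /flip map_cat big_cat.
Qed.

Lemma adjoint_mull a f g : adjoint f g ->
  adjoint (fun x => a * f x) (fun x => g (x * a)).
Proof.
move=> [s [-> ->]]; exists [seq (a * p.1, p.2) | p <- s].
split; apply/funext=> x.
  by rewrite /mulop big_map mulr_sumr; apply: eq_bigr => p _; rewrite !mulrA.
by rewrite !mulop_flip big_map; apply: eq_bigr => p _; rewrite !mulrA.
Qed.

Lemma adjoint_mulr a f g : adjoint f g ->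
  adjoint (fun x => f x * a) (fun x => g (a * x)).
Proof.
move=> [s [-> ->]]; exists [seq (p.1, p.2 * a) | p <- s].
split; apply/funext=> x.
  by rewrite /mulop big_map mulr_suml; apply: eq_bigr => p _; rewrite !mulrA.
by rewrite !mulop_flip big_map; apply: eq_bigr => p _; rewrite !mulrA.
Qed.

Lemma adjoint_argl a f g : adjoint f g ->
  adjoint (fun x => f (a * x)) (fun x => g x * a).
Proof. by move/adjoint_sym/(adjoint_mulr a)/adjoint_sym. Qed.

Lemma adjoint_argr a f g : adjoint f g ->
  adjoint (fun x => f (x * a)) (fun x => a * g x).
Proof. by move/adjoint_sym/(adjoint_mull a)/adjoint_sym. Qed.

Lemma adjointN f g : adjoint f g -> adjoint (fun x => - f x) (fun x => - g x).
Proof.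
move=> [s [-> ->]]; exists [seq (- p.1, p.2) | p <- s].
split; apply/funext=> x.
  by rewrite /mulop big_map -sumrN; apply: eq_bigr => p _; rewrite !mulNr.
by rewrite !mulop_flip big_map -sumrN; apply: eq_bigr => p _; rewrite mulrN.
Qed.

Lemma adjointB f g f' g' : adjoint f g -> adjoint f' g' ->
  adjoint (fun x => f x - f' x) (fun x => g x - g' x).
Proof. by move=> fg /adjointN; apply: adjointD. Qed.

Lemma adjoint_sum (I : eqType) (r : seq I) (F G : I -> R -> R) :
  (forall i, i \in r -> adjoint (F i) (G i)) ->
  adjoint (fun x => \sum_(i <- r) F i x) (fun x => \sum_(i <- r) G i x).
Proof.
elim: r => [|i r IH] FG.
  rewrite (_ : (fun _ => _) = fun=> 0); last by apply/funext=> x; rewrite big_nil.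
  rewrite [X in adjoint _ X](_ : _ = fun=> 0); first exact: adjoint0.
  by apply/funext=> x; rewrite big_nil.
have [j jr|] := adjointD (FG i (mem_head _ _)) (IH _).
  by apply: FG; rewrite inE jr orbT.
move=> s sE; exists s; move: sE.
by case=> <- <-; split; apply/funext=> x; rewrite big_cons.
Qed.

Lemma is_mulop_id : is_mulop id.
Proof. exact: adjoint_mulop adjoint_id. Qed.

Lemma is_mulopB f g : is_mulop f -> is_mulop g -> is_mulop (fun x => f x - g x).
Proof.
by move=> /mulop_adjoint[f' ff] /mulop_adjoint[g' /(adjointB ff)/adjoint_mulop].
Qed.

Lemma is_mulop_mull a f : is_mulop f -> is_mulop (fun x => a * f x).
Proof. by move=> /mulop_adjoint[g /(adjoint_mull a)/adjoint_mulop]. Qed.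

Lemma is_mulop_mulr a f : is_mulop f -> is_mulop (fun x => f x * a).
Proof. by move=> /mulop_adjoint[g /(adjoint_mulr a)/adjoint_mulop]. Qed.

Lemma is_mulop_sum (I : eqType) (r : seq I) (F : I -> R -> R) :
  (forall i, i \in r -> is_mulop (F i)) ->
  is_mulop (fun x => \sum_(i <- r) F i x).
Proof.
move=> rF; have /choice[G FG] : forall i, exists g, i \in r -> adjoint (F i) g.
  move=> i; case: (boolP (i \in r)) => [/rF/mulop_adjoint[g fg]|_].
    by exists g.
  by exists id.
exact: adjoint_mulop (adjoint_sum FG).
Qed.

Lemma is_mulop_comp f g : is_mulop f -> is_mulop g -> is_mulop (f \o g).
Proof.
move=> [s ->] g_op; apply: is_mulop_sum => p _.
exact/is_mulop_mulr/is_mulop_mull.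
Qed.

Lemma is_mulop_additive f : is_mulop f -> zmod_morphism f.
Proof.
case=> s -> x y; rewrite /mulop -sumrB; apply: eq_bigr => p _.
by rewrite mulrBr mulrBl.
Qed.

Lemma mulop0 f : is_mulop f -> f 0 = 0.
Proof. by move=> fo; have := is_mulop_additive fo 0 0; rewrite !subrr. Qed.

Lemma mulopD f x y : is_mulop f -> f (x + y) = f x + f y.
Proof.
move=> fo; have fB := is_mulop_additive fo.
by rewrite -{1}[y]opprK -(sub0r y) fB fB mulop0 // sub0r opprK.
Qed.

Lemma mulop_sum f (I : Type) (r : seq I) (P : pred I) F : is_mulop f ->
  f (\sum_(i <- r | P i) F i) = \sum_(i <- r | P i) f (F i).
Proof.
move=> fo; apply: (big_ind2 (fun x y => f x = y)) => //; first exact: mulop0.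
by move=> x _ y _ <- <-; apply: mulopD.
Qed.

(** In a term [p * a i * q] of [E (a i)] the factor [q] is absorbed by the free variable [x] and [p]
    is pulled out on the left. *)
Lemma mulop_left_coef E (I : Type) (r : seq I) (a b : I -> R) : is_mulop E ->
  (forall x, \sum_(i <- r) a i * x * b i = 0) ->
  forall x, \sum_(i <- r) E (a i) * x * b i = 0.
Proof.
move=> [s ->] ab0 x; rewrite (eq_bigr (fun i => \sum_(p <- s)
  p.1 * (a i * (p.2 * x) * b i))).
  by rewrite exchange_big /= big1 // => p _; rewrite -mulr_sumr ab0 mulr0.
by move=> i _; rewrite /mulop !mulr_suml; apply: eq_bigr => p _; rewrite !mulrA.
Qed.

Lemma mulop_right_coef E (I : Type) (r : seq I) (a b : I -> R) : is_mulop E ->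
  (forall x, \sum_(i <- r) a i * x * b i = 0) ->
  forall x, \sum_(i <- r) a i * x * E (b i) = 0.
Proof.
move=> [s ->] ab0 x; rewrite (eq_bigr (fun i => \sum_(p <- s)
  (a i * (x * p.1) * b i) * p.2)).
  by rewrite exchange_big /= big1 // => p _; rewrite -mulr_suml ab0 mul0r.
by move=> i _; rewrite /mulop mulr_sumr; apply: eq_bigr => p _; rewrite !mulrA.
Qed.

Hypothesis pR : prime_ring R.
Notation dual_system := (@dual_system R R is_mulop).
Notation spans := (@spans R R is_mulop).

Section SpanningSystem.
Variables (n : nat) (a : nat -> R) (E : nat -> R -> R) (w : R) (Y : set R).
Hypotheses (sys : dual_system n a E w) (sp : spans n a Y).

Let Eop (i : 'I_n) : is_mulop (E i). Proof. by case: sys => _ Eo _; apply: Eo. Qed.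
Let Ea (i j : 'I_n) : E i (a j) = if i == j then w else 0.
Proof. by case: sys => _ _ ->. Qed.

(** The expansion of [x] in the family [a], multiplied by [w * y]: the scalar is moved from [a i] to
    [w], where it becomes [E i x]. The difference of the two sides is an operator in [x] that
    vanishes at every [a j]. *)
Lemma dual_expand_l y x : Y x -> w * y * x = \sum_(i < n) E i x * y * a i.
Proof.
move=> Yx; apply/eqP; rewrite -subr_eq0; apply/eqP.
apply: (sp (T := fun x => w * y * x - \sum_(i < n) E i x * y * a i)) => //.
  apply: is_mulopB; first exact/is_mulop_mull/is_mulop_id.
  by apply: is_mulop_sum => i _; do 2!apply: is_mulop_mulr.
move=> j jn; rewrite (bigD1 (Ordinal jn)) //= big1 ?addr0; last first.
  by move=> i ij; rewrite (Ea i (Ordinal jn)) (negbTE ij) !mul0r.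
by rewrite (Ea (Ordinal jn) (Ordinal jn)) eqxx subrr.
Qed.

Lemma dual_expand_r y x : Y x -> x * y * w = \sum_(i < n) a i * y * E i x.
Proof.
move=> Yx; apply/eqP; rewrite -subr_eq0; apply/eqP.
apply: (sp (T := fun x => x * y * w - \sum_(i < n) a i * y * E i x)) => //.
  apply: is_mulopB; first exact/is_mulop_mulr/is_mulop_mulr/is_mulop_id.
  by apply: is_mulop_sum => i _; apply: is_mulop_mull.
move=> j jn; rewrite (bigD1 (Ordinal jn)) //= big1 ?addr0; last first.
  by move=> i ij; rewrite (Ea i (Ordinal jn)) (negbTE ij) !mulr0.
by rewrite (Ea (Ordinal jn) (Ordinal jn)) eqxx subrr.
Qed.

(** This expresses that [E i x] is a scalar multiple of [w]; it suffices to check it at the [a j],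
    where [E i] is [w] or 0. *)
Lemma dual_coef_comm (i : 'I_n) y x : Y x -> E i x * y * w = w * y * E i x.
Proof.
move=> Yx; apply/eqP; rewrite -subr_eq0; apply/eqP.
apply: (sp (T := fun x => E i x * y * w - w * y * E i x)) => //.
  by apply: is_mulopB; [do 2!apply: is_mulop_mulr | apply: is_mulop_mull].
move=> j jn; rewrite (Ea i (Ordinal jn)).
by case: eqP; rewrite ?mul0r ?mulr0 subrr.
Qed.

Lemma dual_coef_comm2 (i j : 'I_n) y x x' : Y x -> Y x' ->
  E i x * y * E j x' = E j x' * y * E i x.
Proof.
move=> Yx Yx'; apply/eqP; rewrite -subr_eq0; apply/eqP.
apply: (sp (T := fun x => E i x * y * E j x' - E j x' * y * E i x)) => //.
  by apply: is_mulopB; [do 2!apply: is_mulop_mulr | apply: is_mulop_mull].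
move=> k kn; rewrite (Ea i (Ordinal kn)).
case: eqP => _; last by rewrite !mul0r mulr0 subrr.
by rewrite dual_coef_comm // subrr.
Qed.

End SpanningSystem.

Lemma mulop_finite_basis L (d : nat -> R) :
  exists n a E w, [/\ dual_system n a E w,
    forall i, (i < n)%N -> exists2 l, (l < L)%N & d l = a i &
    spans n a [set x | exists2 l, (l < L)%N & d l = x]].
Proof.
apply: finite_basis => //; first exact: is_mulopB.
  by move=> u T; apply: is_mulop_mull.
by move=> u T; apply: is_mulop_mulr.
Qed.

(* A relation of independence moves across the tensor sign: [a x b] sums to
   zero iff [b x a] does, because the coefficients are central up to [w]. *)
Lemma flip0 n a E w : dual_system n a E w -> spans n a setT ->
  forall f g, adjoint f g -> (forall x, f x = 0) -> forall x, g x = 0.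
Proof.
move=> sys sp f g [s [-> ->]] f0 x; rewrite mulop_flip.
have [w0 Eop _] := sys.
have E0 (j : 'I_n) z : \sum_(p <- s) E j p.1 * z * p.2 = 0.
  by apply: mulop_left_coef => //; apply: Eop.
(* After multiplication by [w * y], the scalar coefficient [E j p.1] moves from the right end to the
   left end by [dual_coef_comm], which reduces the sum to [E0]. *)
have E0' (j : 'I_n) z : \sum_(p <- s) p.2 * z * E j p.1 = 0.
  apply: (prime_lcancel pR w0) => y; rewrite mulr_sumr.
  rewrite (eq_bigr (fun p => (E j p.1 * y * p.2) * (z * w))).
    by rewrite -mulr_suml E0 mul0r.
  move=> p _; have := dual_coef_comm sys sp j (y * p.2 * z) (x := p.1) I.
  by rewrite !mulrA => <-.
apply: (prime_rcancel pR w0) => y; rewrite !mulr_suml.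
rewrite (eq_bigr (fun p => \sum_(j < n) p.2 * (x * a j * y) * E j p.1)).
  by rewrite exchange_big /= big1 // => j _; apply: E0'.
move=> p _; rewrite -!mulrA (mulrA p.1) (dual_expand_r sys sp) //.
by rewrite !mulr_sumr; apply: eq_bigr => j _; rewrite !mulrA.
Qed.

End MultiplicationOperators.

(** * Operators of finite rank *)

Section FiniteRank.
Variable R : pzRingType.
Hypothesis pR : prime_ring R.
Notation dual_system := (@dual_system R R (@is_mulop R)).
Notation spans := (@spans R R (@is_mulop R)).

Definition finite_rank (T : R -> R) := exists L d, spans L d (range T).

(** If [th] is a scalar times [w], the scalar passes out of [E] and is handed to the factor [w] on
    the right. *)
Lemma mulop_scalar_swap (E : R -> R) th w z y : is_mulop E ->
  (forall x, th * x * w = w * x * th) ->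
  E (th * z) * y * w = E (w * z) * y * th.
Proof.
move=> [s ->] thw; rewrite /mulop !mulr_suml; apply: eq_bigr => p _.
by have := congr1 (fun t => p.1 * t) (thw (z * p.2 * y)); rewrite !mulrA.
Qed.

(** Write the entries of [r] as (a_k, b_k, c_k). An operator that kills the left coefficients of
    [r'] leaves a relation among the terms of [r] alone. It follows that z |-> sum_k F_j(c_k) p a_k
    z b_k has its range in the span of finitely many multiples of the left coefficients of [r'], so
    it is zero by hypothesis. These operators are the coordinates of the sum over [r] in a basis of
    the c_k. *)
Lemma separate_orders :
  (forall T, is_mulop T -> finite_rank T -> forall x, T x = 0) ->
  forall r r' : seq (R * R * R),
  (forall x y, \sum_(k <- r) k.1.1 * x * k.1.2 * y * k.2 +
               \sum_(k <- r') k.1.1 * y * k.1.2 * x * k.2 = 0) ->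
  forall x y, \sum_(k <- r) k.1.1 * x * k.1.2 * y * k.2 = 0.
Proof.
move=> nofin r r' H x y; pose c l := (nth (0, 0, 0) r l).2.
have [n [c0 [F [w [sys _ sp]]]]] := mulop_finite_basis pR (size r) c.
set Y := [set _ | _] in sp.
have Yk k : k \in r -> Y k.2.
  by move=> kr; exists (index k r); rewrite ?index_mem // /c nth_index.
have [w0 Fop _] := sys.
(* For fixed [x] the identity is a relation in [y], with left coefficients [k.1.1 * x * k.1.2] on
   [r] and [k.1.1] on [r']. *)
have kill (E : R -> R) : is_mulop E -> (forall k, k \in r' -> E k.1.1 = 0) ->
    forall x y, \sum_(k <- r) E (k.1.1 * x * k.1.2) * y * k.2 = 0.
  move=> Eop Er' x1 y1.
  pose t := [seq (k.1.1 * x1 * k.1.2, k.2) | k <- r] ++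
            [seq (k.1.1, k.1.2 * x1 * k.2) | k <- r'].
  have := @mulop_left_coef R E _ t fst snd Eop.
  rewrite /t; move=> /(_ _ y1); rewrite big_cat !big_map /=.
  rewrite [X in _ + X]big1_seq ?addr0; last first.
    by move=> k /= kr'; rewrite Er' // !mul0r.
  apply=> x2; rewrite big_cat !big_map /= -[RHS](H x1 x2); congr (_ + _).
  by apply: eq_bigr => k _; rewrite !mulrA.
have T0 (j : 'I_n) p z : \sum_(k <- r) F j k.2 * p * k.1.1 * z * k.1.2 = 0.
  pose T z := \sum_(k <- r) F j k.2 * p * k.1.1 * z * k.1.2.
  apply: (nofin T).
    by apply: is_mulop_sum => k _; apply/is_mulop_mulr/is_mulop_mull/is_mulop_id.
  exists (size r'), (fun l => w * p * (nth (0, 0, 0) r' l).1.1).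
  move=> E Eop Ed _ [x1 _ <-]; apply: (prime_rcancel pR w0) => y1.
  have := @mulop_right_coef R (F j) _ r (fun k => E (w * p * (k.1.1 * x1 * k.1.2)))
    (fun k => k.2) (Fop _ (ltn_ord j)) _ y1.
  rewrite /T mulop_sum // !mulr_suml => mr; rewrite -[RHS]mr; last first.
    apply: (kill (fun z => E (w * p * z))).
      by apply: is_mulop_comp => //; apply/is_mulop_mull/is_mulop_id.
    by move=> k kr'; rewrite -(nth_index (0, 0, 0) kr') Ed // index_mem.
  apply: eq_big_seq => k kr; rewrite -!mulrA mulrA.
  rewrite (@mulop_scalar_swap _ _ w) //; last first.
    by move=> t; apply: (dual_coef_comm sys sp); apply: Yk.
  by rewrite !mulrA.
apply: (prime_lcancel pR w0) => p; rewrite mulr_sumr.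
rewrite (eq_big_seq (fun k => \sum_(j < n)
    (F j k.2 * p * k.1.1 * x * k.1.2) * (y * c0 j))); last first.
  move=> k kr; have := dual_expand_l sys sp (p * k.1.1 * x * k.1.2 * y) (Yk k kr).
  by rewrite !mulrA => ->; apply: eq_bigr => j _; rewrite !mulrA.
by rewrite exchange_big /= big1 // => j _; rewrite -mulr_suml T0 mul0r.
Qed.

(** The composite of [T] with a coordinate on its range has rank one: all values of [G] are scalar
    multiples of [w]. Some coordinate of [T z] is nonzero, for otherwise [dual_expand_l] would give
    [T z = 0]. *)
Lemma finite_rank_scalar (T : R -> R) z : is_mulop T -> finite_rank T -> T z != 0 ->
  exists (G : R -> R) (w : R), [/\ is_mulop G, w != 0, exists x, G x != 0 &
    forall x y, G x * y * w = w * y * G x].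
Proof.
move=> Top [L [d sd]] Tz.
have [n [c [F [w [sys _ sp]]]]] := mulop_finite_basis pR L d.
have sp' : spans n c (range T).
  by move=> E Eop Ec; apply: sd => // l lL; apply: (sp E Eop Ec); exists l.
have [w0 Fop _] := sys.
have [[j Fj]|nF] := pselect (exists j : 'I_n, F j (T z) != 0).
  exists (F j \o T), w; split=> //; first exact: is_mulop_comp (Fop _ (ltn_ord j)) Top.
    by exists z.
  by move=> x y; apply: (dual_coef_comm sys sp'); exists x.
case/eqP: Tz; apply: (prime_lcancel pR w0) => y.
rewrite (dual_expand_l sys sp') //.
rewrite big1 // => j _; suff -> : F j (T z) = 0 by rewrite !mul0r.
by apply: contrapT => /eqP Fj; apply: nF; exists j.
Qed.

(** Let G x = sum_k p_k x q_k. The relation w y G(x) = G(x) y w shows that an operator E killing all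
    p_k satisfies sum_k E(w y p_k) x q_k = 0. Passing to the coordinates H_j of the q_k gives E(w y
    u) = 0 for u = sum_k H_j(q_k) r p_k, so w R u lies in the span of the p_k. If every such u
    vanished, expanding the q_k would give G = 0. *)
Lemma scalar_mulop_corner (G : R -> R) w x : is_mulop G -> w != 0 -> G x != 0 ->
  (forall x y, G x * y * w = w * y * G x) ->
  exists (u : R) L d, u != 0 /\ spans L d (range (fun y => w * y * u)).
Proof.
move=> [s ->] w0 Gx Gw; pose v l := (nth (0, 0) s l).2.
have [n [c [H [w' [sys _ sp]]]]] := mulop_finite_basis pR (size s) v.
set Y := [set _ | _] in sp.
have Yk k : k \in s -> Y k.2.
  by move=> ks; exists (index k s); rewrite ?index_mem // /v nth_index.
have [w'0 Hop _] := sys.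
have [[j [p u0]]|nu] := pselect (exists (j : 'I_n) p,
    \sum_(k <- s) H j k.2 * p * k.1 != 0); last first.
  case/eqP: Gx; apply: (prime_lcancel pR w'0) => p; rewrite mulr_sumr.
  rewrite (eq_big_seq (fun k => \sum_(j < n)
    (H j k.2 * p * k.1) * (x * c j))); last first.
    move=> k ks; have := dual_expand_l sys sp (p * k.1 * x) (Yk k ks).
    by rewrite !mulrA => ->; apply: eq_bigr => j _; rewrite !mulrA.
  rewrite exchange_big /= big1 // => j _; rewrite -mulr_suml.
  suff -> : \sum_(k <- s) H j k.2 * p * k.1 = 0 by rewrite mul0r.
  by apply: contrapT => /eqP Hj; apply: nu; exists j, p.
exists (\sum_(k <- s) H j k.2 * p * k.1), (size s), (fun l => (nth (0, 0) s l).1).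
split=> // E Eop Ed _ [y _ <-].
have Es k : k \in s -> E k.1 = 0.
  by move=> ks; rewrite -(nth_index (0, 0) ks) Ed // index_mem.
have E0 y1 x1 : \sum_(k <- s) E (w * y1 * k.1) * x1 * k.2 = 0.
  pose t := [seq (k.1, k.2 * y1 * w) | k <- s] ++
            [seq (w * y1 * k.1, - k.2) | k <- s].
  have := @mulop_left_coef R E _ t fst snd Eop.
  rewrite /t; move=> /(_ _ x1); rewrite big_cat !big_map /=.
  rewrite big1_seq ?add0r; last by move=> k /= ks; rewrite Es // !mul0r.
  under eq_bigr do rewrite mulrN.
  rewrite sumrN => /(_ _)/eqP; rewrite oppr_eq0 => HH; apply/eqP/HH.
  move=> x2; rewrite big_cat !big_map /=.
  rewrite [X in _ + X](_ : _ = - (w * y1 * mulop s x2)).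
    rewrite -Gw /mulop !mulr_suml -sumrB big1 // => k _.
    by rewrite !mulrA subrr.
  by rewrite /mulop mulr_sumr -sumrN; apply: eq_bigr => k _; rewrite mulrN !mulrA.
apply: (prime_rcancel pR w'0) => x1.
rewrite mulr_sumr mulop_sum // !mulr_suml.
rewrite (eq_big_seq (fun k => E (w * (y * w' * p) * k.1) * x1 * H j k.2)).
  apply: (mulop_right_coef (Hop _ (ltn_ord j)) (E0 (y * w' * p))).
move=> k ks; have := @mulop_scalar_swap (fun t => E (w * y * t)) (H j k.2) w'
  (p * k.1) x1; rewrite !mulrA; apply.
  by apply: is_mulop_comp => //; apply/is_mulop_mull/is_mulop_id.
by move=> t; apply: (dual_coef_comm sys sp); apply: Yk.
Qed.

End FiniteRank.

(** * Polynomial identities *)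

Section WordIdentities.
Variable R : pzRingType.
Implicit Types (x : nat -> R) (W : seq (int * seq nat)) (w : seq nat).

Definition word_eval x w : R := \prod_(i <- w) x i.

Definition words_eval x W : R := \sum_(p <- W) word_eval x p.2 *~ p.1.

Definition words_identity W := forall x, words_eval x W = 0.

Definition update x (i : nat) (a : R) := fun j => if j == i then a else x j.

Lemma word_eval_cat x w w' : word_eval x (w ++ w') = word_eval x w * word_eval x w'.
Proof. by rewrite /word_eval big_cat. Qed.

Lemma word_eval_cons x i w : word_eval x (i :: w) = x i * word_eval x w.
Proof. by rewrite /word_eval big_cons. Qed.

Lemma word_eval_update x i a w : i \notin w ->
  word_eval (update x i a) w = word_eval x w.
Proof.
move=> iw; apply: eq_big_seq => j jw; rewrite /update.
by case: eqP => // ji; rewrite -ji jw in iw.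
Qed.

(** Substituting 0 for the variable [i] shows that the words without [i] already form an
    identity. *)
Lemma words_identity_occ i W : words_identity W ->
  words_identity [seq p <- W | i \in p.2].
Proof.
move=> W0 x; have := W0 (update x i 0); rewrite /words_eval.
rewrite (bigID (fun p => i \in p.2)) /= big1 ?add0r; last first.
  move=> p ip; suff -> : word_eval (update x i 0) p.2 = 0 by rewrite mul0rz.
  case/splitPr: ip => p1 p2; rewrite word_eval_cat word_eval_cons.
  by rewrite {2}/update eqxx mul0r mulr0.
under eq_bigr => p ip do rewrite word_eval_update //.
move=> E; have := W0 x; rewrite /words_eval (bigID (fun p => i \in p.2)) /= E addr0.
by rewrite big_filter.
Qed.

Lemma words_identity_all_occ (s : seq nat) W : words_identity W ->
  words_identity [seq p <- W | all (fun i => i \in p.2) s].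
Proof.
elim: s => [|i s IH] W0; first by rewrite filter_predT.
by rewrite /= filter_predI; apply/words_identity_occ/IH.
Qed.

Hypothesis pR : prime_ring R.
Hypothesis nofin :
  forall T : R -> R, is_mulop T -> finite_rank T -> forall z, T z = 0.

Lemma split_before w i j : uniq w -> i \in w -> (index i w < index j w)%N ->
  j \in w -> exists t : seq nat * seq nat * seq nat,
    w = t.1.1 ++ i :: t.1.2 ++ j :: t.2.
Proof.
move=> uw iw ij jw; case/splitPr: iw => p1 p2 in uw ij jw *.
move: uw; rewrite cat_uniq /= => /and3P[up1 /norP[ip1 _] _].
have jp1 : j \notin p1.
  apply/negP => jp1; move: ij; rewrite !index_cat (negbTE ip1) jp1 /= eqxx addn0.
  by rewrite ltnNge index_size.
have jp2 : j \in p2.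
  move: jw ij; rewrite mem_cat (negbTE jp1) inE /= => /predU1P[->|//].
  by rewrite ltnn.
by case/splitPr: jp2 => q1 q2; exists (p1, q1, q2).
Qed.

(** With the other variables fixed, each word has the form A x_i B x_j C or A x_j B x_i C, as in
    [separate_orders]. *)
Lemma words_identity_order i j W : i != j ->
  (forall p, p \in W -> [/\ uniq p.2, i \in p.2 & j \in p.2]) ->
  words_identity W ->
  words_identity [seq p <- W | (index i p.2 < index j p.2)%N].
Proof.
move=> ij Wij W0 x.
have /choice[cut cutP] : forall w, exists t : (seq nat * seq nat * seq nat) *
    (seq nat * seq nat * seq nat), uniq w -> i \in w -> j \in w ->
    if (index i w < index j w)%N then w = t.1.1.1 ++ i :: t.1.1.2 ++ j :: t.1.2
    else w = t.2.1.1 ++ j :: t.2.1.2 ++ i :: t.2.2.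
  move=> w; case: (pselect [/\ uniq w, i \in w & j \in w]) => [[uw iw jw]|nw].
    case: ltnP => [lt|].
      by have [t tE] := split_before uw iw lt jw; exists (t, t).
    rewrite leq_eqVlt => /predU1P[ji|lt].
      by case/eqP: ij; rewrite -(nth_index 0%N iw) -ji nth_index.
    by have [t tE] := split_before uw jw lt iw; exists (t, t).
  by exists (([::], [::], [::]), ([::], [::], [::])) => uw iw jw; case: nw.
pose tr (a : int) (t : seq nat * seq nat * seq nat) : R * R * R :=
  (word_eval x t.1.1 *~ a, word_eval x t.1.2, word_eval x t.2).
pose b (p : int * seq nat) := (index i p.2 < index j p.2)%N.
have ev2 i' j' (t : seq nat * seq nat * seq nat) X Y a : i' != j' ->
    uniq (t.1.1 ++ i' :: t.1.2 ++ j' :: t.2) ->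
    word_eval (update (update x i' X) j' Y) (t.1.1 ++ i' :: t.1.2 ++ j' :: t.2) *~ a =
    (tr a t).1.1 * X * (tr a t).1.2 * Y * (tr a t).2.
  case: t => [[p1 p2] p3] ij' /=; rewrite cat_uniq /= cat_uniq /= !mem_cat !inE.
  move=> /and5P[_ nh + _ /and3P[nh2 + _]].
  move: nh; rewrite !negb_or has_cat /= !negb_or => /and3P[ip1 _ /andP[jp1 _]].
  move=> /andP[ip2 /andP[_ ip3]] jp3.
  have jp2 : j' \notin p2 by move: nh2; rewrite negb_or => /andP[].
  rewrite !(word_eval_cat, word_eval_cons) !word_eval_update //.
  rewrite /update eqxx (negbTE ij') eqxx.
  by rewrite -!mulrzAl !mulrA.
pose r := [seq tr p.1 (cut p.2).1 | p <- W & b p].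
pose r' := [seq tr p.1 (cut p.2).2 | p <- W & ~~ b p].
have evW X Y : words_eval (update (update x i X) j Y) W =
   \sum_(k <- r) k.1.1 * X * k.1.2 * Y * k.2 +
   \sum_(k <- r') k.1.1 * Y * k.1.2 * X * k.2.
  rewrite /words_eval (bigID b) /= !big_map !big_filter; congr (_ + _).
    rewrite big_seq_cond [RHS]big_seq_cond; apply: eq_bigr => p /andP[pW bp].
    have [up ip jp] := Wij p pW; have := cutP _ up ip jp.
    rewrite -/(b p) bp => wE; rewrite {1}wE ev2 // -?wE //.
  rewrite big_seq_cond [RHS]big_seq_cond; apply: eq_bigr => p /andP[pW bp].
  have [up ip jp] := Wij p pW; have := cutP _ up ip jp.
  rewrite -/(b p) (negbTE bp) => wE; rewrite {1}wE -(ev2 j i _ Y X p.1) -?wE // 1?eq_sym //.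
  congr (_ *~ _); apply: eq_bigr => l _; rewrite /update.
  by case: eqP => // ->; rewrite eq_sym (negbTE ij).
have := @separate_orders R pR nofin r r'.
move=> /(_ (fun X Y => etrans (esym (evW X Y)) (W0 _)) (x i) (x j)) => <-.
rewrite /words_eval /r big_map.
rewrite big_seq_cond [RHS]big_seq_cond; apply: eq_bigr => p.
rewrite mem_filter andbT => /andP[bp pW].
have [up ip jp] := Wij p pW; have := cutP _ up ip jp.
rewrite bp => wE; rewrite {1}wE -(ev2 i j _ (x i) (x j) p.1) -?wE //.
congr (_ *~ _); apply: eq_bigr => l _; rewrite /update.
by case: eqP => [->//|_]; case: eqP => [->|].
Qed.

Lemma words_identity_orders (s : seq (nat * nat)) W :
  (forall q, q \in s -> q.1 != q.2 /\
    forall p, p \in W -> [/\ uniq p.2, q.1 \in p.2 & q.2 \in p.2]) ->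
  words_identity W -> words_identity
    [seq p <- W | all (fun q => (index q.1 p.2 < index q.2 p.2)%N) s].
Proof.
elim: s => [|q s IH] sW W0; first by rewrite filter_predT.
rewrite /= filter_predI; apply: words_identity_order.
- by have [] := sW q (mem_head _ _).
- move=> p; rewrite mem_filter => /andP[_ pW].
  by have [_] := sW q (mem_head _ _); apply.
- by apply: IH => // q' q's; apply: sW; rewrite inE q's orbT.
Qed.

(** A word of length at most [d] in which 0, ..., d-1 all occur is a permutation, and only
    [iota 0 d] has every pair in increasing order. The identity left over, evaluated with all
    variables equal to 1, reads 1 = 0. *)
Lemma no_monic_words_identity d W :
  (forall p, p \in W -> (size p.2 <= d)%N) ->
  \sum_(p <- W | p.2 == iota 0 d) p.1 = 1 -> ~ words_identity W.
Proof.
move=> Wd W1 W0; have [/eqP[]] := pR.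
pose W' := [seq p <- W | all (fun i => i \in p.2) (iota 0 d)].
have W'P p : p \in W' -> uniq p.2 /\ p.2 =i iota 0 d.
  rewrite mem_filter => /andP[/allP pi /Wd pd].
  have pd' : (size p.2 <= size (iota 0 d))%N by rewrite size_iota.
  split; first exact: leq_size_uniq (iota_uniq 0 d) pi pd'.
  by have [_ pE] := uniq_min_size (iota_uniq 0 d) pi pd' => i; rewrite pE.
pose prs := [seq q <- [seq (i, j) | i <- iota 0 d, j <- iota 0 d] | (q.1 < q.2)%N].
pose W2 := [seq p <- W' | all (fun q => (index q.1 p.2 < index q.2 p.2)%N) prs].
have W20 : words_identity W2.
  apply: words_identity_orders; last exact: words_identity_all_occ.
  move=> [i j]; rewrite mem_filter /= => /andP[lt /allpairsP[[k l] /= [kd ld [ik jl]]]].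
  split=> [|p /W'P[up pE]]; first by rewrite neq_ltn lt.
  by rewrite !pE ik jl.
have W2E : W2 = [seq p <- W | p.2 == iota 0 d].
  rewrite /W2 /W' -filter_predI; apply: eq_in_filter => p pW /=.
  apply/andP/eqP => [[/allP pp pi]|->].
    have /W'P[up pE] : p \in W' by rewrite mem_filter pi.
    apply: (irr_sorted_eq ltn_trans ltnn) => //; last exact: iota_ltn_sorted.
    rewrite sorted_pairwise; last exact: ltn_trans.
    apply/(pairwiseP 0%N) => a b; rewrite !inE => ap bp ab.
    rewrite ltnNge leq_eqVlt; apply/negP => /predU1P[|lt].
      by move/eqP; rewrite nth_uniq // => /eqP ba; rewrite ba ltnn in ab.
    have := pp (nth 0%N p.2 b, nth 0%N p.2 a).
    rewrite mem_filter /= lt allpairs_f -?pE ?mem_nth // !index_uniq //.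
    by move=> /(_ isT); rewrite ltnNge ltnW.
  split; last by apply/allP.
  apply/allP => -[i j]; rewrite mem_filter /= => /andP[lt].
  move=> /allpairsP[[k l] /= [+ + [ik jl]]]; rewrite -ik -jl !mem_iota /= !add0n => id jd.
  have idx k' : (k' < d)%N -> index k' (iota 0 d) = k'.
    move=> kd; rewrite -[X in index X _](nth_iota 0 0 kd).
    by rewrite index_uniq ?size_iota ?iota_uniq.
  by rewrite !idx.
have := W20 (fun=> 1); rewrite W2E /words_eval.
rewrite (eq_bigr (fun p : int * seq nat => 1 *~ p.1)); last first.
  by move=> p _; rewrite /word_eval big1_eq.
by rewrite big_filter -mulrz_sumr W1.
Qed.

End WordIdentities.

(** * Linearization of a monic identity *)

Section Expansion.
Variables (R : pzRingType) (u : seq nat).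

Definition positions (i : nat) := [seq p <- iota 0 (size u) | nth 0%N u p == i].

(** The words produced by the monomial [m] when each x_i is replaced by the sum of fresh variables
    y_p, over the positions [p] of [i] in [u]. *)
Fixpoint expand (m : seq nat) : seq (seq nat) :=
  if m is i :: m' then [seq p :: w | p <- positions i, w <- expand m'] else [:: [::]].

Lemma size_expand m w : w \in expand m -> size w = size m.
Proof.
elim: m w => [|i m IH] w /=; first by rewrite inE => /eqP->.
by case/allpairsP=> -[p w'] /= [_ /IH mw' ->] /=; rewrite mw'.
Qed.

Lemma expand_uniq m : uniq (expand m).
Proof.
elim: m => //= i m IH; apply: allpairs_uniq => //.
  exact/filter_uniq/iota_uniq.
by move=> [p w] [p' w'] _ _ [-> ->].
Qed.

Lemma mem_expand m w : (w \in expand m) =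
  all (fun p => p < size u)%N w && ([seq nth 0%N u p | p <- w] == m).
Proof.
elim: m w => [|i m IH] [|p w] //=.
- by rewrite inE andbF.
- by apply/allpairsP => -[[p w] /= []].
- apply/allpairsP/andP => [[[p' w'] /= [pp ww [-> ->]]]|[/andP[pu wu] /eqP[pE wE]]].
    move: pp ww; rewrite mem_filter mem_iota /= add0n => /andP[/eqP-> ->].
    by rewrite IH => /andP[-> /eqP->].
  exists (p, w); split=> //=; last by rewrite IH wu wE eqxx.
  by rewrite mem_filter mem_iota pE eqxx.
Qed.

Lemma expand_eval (y : nat -> R) m :
  \prod_(i <- m) \sum_(p <- positions i) y p = \sum_(w <- expand m) word_eval y w.
Proof.
elim: m => [|i m IH] /=.
  by rewrite big_nil big_seq1 /word_eval big_nil.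
rewrite big_cons IH big_allpairs_dep mulr_suml; apply: eq_bigr => p _.
by rewrite mulr_sumr; apply: eq_bigr => w _; rewrite word_eval_cons.
Qed.

End Expansion.

(** Take for [u] a monomial of top degree with coefficient 1. Reading the letters of [u] at the
    places 0, ..., d-1 gives [u] back, so after the substitution the word [iota 0 d] comes from [u]
    only, exactly once. The words that repeat a variable are discarded later. *)
Lemma PI_words_identity (R : pzRingType) : PI_ring R -> exists d (W : seq (int * seq nat)),
  [/\ forall p, p \in W -> (size p.2 <= d)%N,
      \sum_(p <- W | p.2 == iota 0 d) p.1 = 1 & words_identity R W].
Proof.
case=> f [[m [fm mdeg]] f0]; set u := fmonom_val m; pose d := size u.
exists d, [seq (f@_k, w) | k <- msupp f, w <- expand u (fmonom_val k)].
split.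
- move=> p /allpairsPdep[k [w [kf wk ->]]] /=.
  by rewrite (size_expand wk); apply: mdeg.
- have ut : [seq nth 0%N u p | p <- iota 0 d] = u.
    by have := mkseq_nth 0%N u; rewrite /mkseq.
  rewrite big_mkcond big_allpairs_dep /=.
  rewrite (bigD1_seq m) ?fset_uniq //=; last by rewrite -mcoeff_neq0 fm.
  have cnt (k : {fmonom nat}) : \sum_(w <- expand u k) (if w == iota 0 d then f@_k else 0) =
      if fmonom_val k == u then f@_k else 0.
    rewrite -big_mkcond big_const_seq count_uniq_mem ?expand_uniq // mem_expand ut.
    rewrite (_ : all _ _) /=; last by apply/allP => p; rewrite mem_iota.
    by rewrite eq_sym; case: eqP; rewrite /= ?addr0.
  rewrite cnt eqxx fm big1 ?addr0 // => k km; rewrite cnt.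
  case: eqP => // ku; case/eqP: km.
  by case: k m @u fm mdeg d ut cnt ku => [k] [m'] /= *; congr FMonom.
- move=> y; rewrite -[RHS](f0 (fun i => \sum_(p <- positions u i) y p)).
  rewrite /words_eval /free_eval big_allpairs_dep /=; apply: eq_bigr => k _.
  by rewrite expand_eval mulrz_suml.
Qed.

Lemma words_identity_surj (R S : pzRingType) (f : {rmorphism R -> S}) W :
  (forall s, exists r, f r = s) -> words_identity R W -> words_identity S W.
Proof.
move=> /choice[g gf] W0 x; rewrite -[RHS](rmorph0 f) -(W0 (g \o x)).
rewrite /words_eval rmorph_sum; apply: eq_bigr => p _.
rewrite /= rmorphMz rmorph_prod; congr (_ *~ _).
by apply: eq_bigr => i _; rewrite gf.
Qed.

Lemma finite_rank_mulop (R : pzRingType) d W : prime_ring R ->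
  (forall p, p \in W -> (size p.2 <= d)%N) ->
  \sum_(p <- W | p.2 == iota 0 d) p.1 = 1 -> words_identity R W ->
  exists (T : R -> R) z, [/\ is_mulop T, finite_rank T & T z != 0].
Proof.
move=> pR Wd W1 W0; apply: contrapT => nex.
apply: (no_monic_words_identity pR _ Wd W1 W0) => T Top Tfin z.
by apply: contrapT => /eqP Tz; apply: nex; exists T, z.
Qed.

(** * Finite generation from the ascending chain condition *)

Section RightNoetherianSpan.
Variable R : pzRingType.

Fixpoint rspan (l : seq R) : set R :=
  if l is x :: l' then [set z | exists y z', rspan l' z' /\ z = x * y + z']
  else [set 0].

Lemma rspan_right_ideal l : right_ideal (rspan l).
Proof.
elim: l => [|x l [[IH0 IHB] IHM]].
  split; [split=> // _ _ -> ->; exact: subr0|by move=> _ r ->; exact: mul0r].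
split; [split|].
- by exists 0, 0; rewrite mulr0 addr0.
- move=> _ _ [y [z [lz ->]]] [y' [z' [lz' ->]]]; exists (y - y'), (z - z').
  by split; [exact: IHB | rewrite mulrBr addrACA opprD].
- move=> _ r [y [z [lz ->]]]; exists (y * r), (z * r).
  by split; [exact: IHM | rewrite mulrDl mulrA].
Qed.

Lemma rspan_min l (H : set R) : additive_subgroup H ->
  (forall x y, x \in l -> H (x * y)) -> rspan l `<=` H.
Proof.
move=> Hg; elim: l => [_ _ ->|x l IH Hl _ [y [z [lz ->]]]]; first exact: Hg.1.
apply: subgroupD => //; first by apply: Hl; rewrite mem_head.
by apply: IH lz => x' y' x'l; apply: Hl; rewrite inE x'l orbT.
Qed.

Lemma rspan_cons x l : rspan l `<=` rspan (x :: l).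
Proof. by move=> z lz; exists 0, z; rewrite mulr0 add0r. Qed.

Lemma mem_rspan_head x l : rspan (x :: l) x.
Proof.
by exists 1, 0; rewrite mulr1 addr0; have [[]] := rspan_right_ideal l.
Qed.

(** Otherwise, repeatedly adjoining an element of [S] outside the current [rspan] gives a strictly
    ascending chain. The generators are taken in [S] itself so that those of RwR can have the form
    [r * w]. *)
Lemma right_noetherian_fg (S : set R) : right_noetherian R ->
  exists l, (forall x, x \in l -> S x) /\ S `<=` rspan l.
Proof.
move=> Rn; apply: contrapT => nfg.
have /choice[nxt nxtP] : forall l, exists x, (forall y, y \in l -> S y) ->
    S x /\ ~ rspan l x.
  move=> l; case: (pselect (forall y, y \in l -> S y)) => [lS|]; last by exists 0.
  apply: contrapT => nx; apply: nfg; exists l; split=> // x Sx.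
  by apply: contrapT => lx; apply: nx; exists x.
pose l := fix l n := if n is n'.+1 then nxt (l n') :: l n' else [::].
have lS n : forall y, y \in l n -> S y.
  elim: n => //= n IH y; rewrite inE => /predU1P[->|]; last exact: IH.
  by have [] := nxtP _ IH.
have [||n nP] := Rn (fun n => rspan (l n)).
- by move=> n; apply: rspan_right_ideal.
- by move=> n; apply: rspan_cons.
have [_] := nxtP _ (lS n); apply; rewrite -(nP n.+1) //; exact: mem_rspan_head.
Qed.

End RightNoetherianSpan.

(** * Central elements of prime noetherian PI rings *)

Section FullDualSystem.
Variable R : pzRingType.
Hypothesis pR : prime_ring R.
Hypothesis Rn : right_noetherian R.

(* If [w R u] lies in a finite-dimensional space then so does the left ideal
   [R w R u], since [R w R] is finitely generated on the right. *)
Lemma finite_left_ideal (w u : R) L d : w != 0 -> u != 0 ->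
  spans (@is_mulop R) L d (range (fun y => w * y * u)) ->
  exists (V : set R) L' d', [/\ forall r x, V x -> V (r * x),
    exists2 x, V x & x != 0 & spans (@is_mulop R) L' d' V].
Proof.
move=> w0 u0 sd.
have [l [lS Sl]] := right_noetherian_fg (range (fun r => r * w)) Rn.
have /choice[q qE] : forall x, exists r, x \in l -> r * w = x.
  move=> x; case: (boolP (x \in l)) => [/lS[r _ rw]|_]; last by exists 0.
  by exists r.
(* A generator [x = q x * w] contributes [q x * (w * y * u)], and the second factor is in the span
   of the [d k]. *)
pose D := [seq q x * d k | x <- l, k <- iota 0 L].
exists [set z * u | z in rspan l], (size D), (nth 0 D); split.
- move=> r _ [z lz <-]; exists (r * z); last by rewrite mulrA.
  have [Hg HM] := rspan_right_ideal l.
  apply: (rspan_min (H := [set z | rspan l (r * z)])) lz.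
    split; first by rewrite /= mulr0; exact: Hg.1.
    by move=> x y lx ly; rewrite /= mulrBr; apply: Hg.2.
  move=> x y xl; rewrite /= mulrA; apply: HM; apply: Sl.
  by exists (r * q x) => //; rewrite -mulrA qE.
- have [y wyu] := prime_ringP pR w0 u0; exists (w * y * u) => //.
  exists (w * y) => //; have [_] := rspan_right_ideal l; apply; apply: Sl.
  by exists 1; rewrite ?mul1r.
- move=> E Eop ED _ [z lz <-].
  apply: (rspan_min (H := [set z | E (z * u) = 0])) lz.
    split; first by rewrite /= mul0r mulop0.
    by move=> x y /= Ex Ey; rewrite mulrBl is_mulop_additive // Ex Ey subrr.
  move=> x y xl /=; rewrite -(qE _ xl).
  rewrite -!mulrA (mulrA w) (sd (fun t => E (q x * t))) //.
  - by apply: is_mulop_comp => //; apply/is_mulop_mull/is_mulop_id.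
  - move=> k kL; have kD : q x * d k \in D.
      by apply/allpairsPdep; exists x, k; rewrite mem_iota.
    by rewrite -(nth_index 0 kD) ED // index_mem.
Qed.

(** For a basis e_1, ..., e_m of [V], the map x |-> (x e_1, ..., x e_m) is injective into V^m, of
    dimension at most m L. A dual system on [R] is carried over to these vectors, where its size is
    bounded by the exchange lemma. *)
Lemma full_dual_system (V : set R) L d : (forall r x, V x -> V (r * x)) ->
  (exists2 x, V x & x != 0) -> spans (@is_mulop R) L d V ->
  exists n a E w, dual_system (@is_mulop R) n a E w /\ spans (@is_mulop R) n a setT.
Proof.
move=> VM [s0 Vs0 s00] sd.
have opB := @is_mulopB R; have opMl := @is_mulop_mull R.
have opMr := @is_mulop_mulr R.
have [n a E w sys aV|m [e [F [w0 [sys eV se]]]]] :=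
  max_dual_system pR opB opMl opMr (N := L) 0 (Y := V).
  exact: (dual_system_le_spans pR opB opMl opMr sys aV sd).
have [w00 Fop _] := sys.
have [n a E w sys' _|n [a [E [w [sys' _ sp]]]]] :=
  max_dual_system pR opB opMl opMr (N := (m * L)%N) 0 (Y := setT);
  last by exists n, a, E, w.
have [g0 Eop Ea] := sys'.
have /choice[t tE] : forall k, exists t, (k < n)%N -> E k = mulop t.
  move=> k; case: (boolP (k < n)%N) => [/Eop[t tE]|_]; last by exists [::].
  by exists t.
have [s Vs gs] : exists2 s, V s & w * s != 0.
  have [y gy] := prime_ringP pR g0 s00.
  by exists (y * s0); [exact: VM | rewrite mulrA].
have [z gz] := prime_ringP pR gs w00.
pose Op : set ((nat -> R) -> R) := [set T | exists f : nat -> R -> R,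
  (forall j, is_mulop (f j)) /\ T = fun v : nat -> R => \sum_(j < m) f j (v j)].
have OpB T U : Op T -> Op U -> Op (fun v => T v - U v).
  move=> [f [fo ->]] [f' [fo' ->]]; exists (fun j x => f j x - f' j x).
  by split=> [j|]; [exact: opB | apply/funext=> v; rewrite sumrB].
have OpMl r T : Op T -> Op (fun v => r * T v).
  move=> [f [fo ->]]; exists (fun j x => r * f j x).
  by split=> [j|]; [exact: opMl | apply/funext=> v; rewrite mulr_sumr].
have OpMr r T : Op T -> Op (fun v => T v * r).
  move=> [f [fo ->]]; exists (fun j x => f j x * r).
  by split=> [j|]; [exact: opMr | apply/funext=> v; rewrite mulr_suml].
(* Since [p.2 * s] lies in [V], the product [p.2 * s * z * w0] expands in the [e j]. Thus
   [E k x * s * z * w0] depends on [x] only through the [x * e j]. *)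
pose f k j x := \sum_(p <- t k) p.1 * x * (z * F j (p.2 * s)).
pose G k (v : nat -> R) := \sum_(j < m) f k j (v j).
pose vec x : nat -> R := fun j => x * e j.
have GE k x : (k < n)%N -> G k (vec x) = E k x * s * z * w0.
  move=> kn; rewrite tE // /mulop !mulr_suml /G /f exchange_big /=.
  apply: eq_bigr => p _; rewrite -!mulrA (mulrA p.2) (mulrA _ z).
  rewrite (dual_expand_r sys se); last exact: VM.
  by rewrite !mulr_sumr; apply: eq_bigr => j _; rewrite !mulrA.
have sysG : dual_system Op n (vec \o a) G (w * s * z * w0).
  split=> // [k kn|k l kn ln].
    exists (f k); split=> // j; apply: is_mulop_sum => p _.
    exact/is_mulop_mulr/is_mulop_mull/is_mulop_id.
  by rewrite /= GE // Ea //; case: eqP => // _; rewrite !mul0r.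
(* Vectors with a single entry taken from [d]: the quotient of [l] by [L] gives its place, the
   remainder its index. *)
pose D l : nat -> R := fun j => if j == (l %/ L)%N then d (l %% L)%N else 0.
apply: (dual_system_le_spans pR OpB OpMl OpMr sysG (Y := range vec) _ (d := D)).
  by move=> i _; exists (a i).
move=> _ [h [ho ->]] hD _ [x _ <-]; rewrite big1 // => j _.
apply: (sd (h j)) => //; last by apply/VM/eV.
move=> i iL; have L0 : (0 < L)%N by case: (L) iL.
rewrite -[RHS](hD (j * L + i)%N); last first.
  by rewrite (leq_trans _ (leq_mul (ltn_ord j) (leqnn L))) // mulSn addnC ltn_add2r.
rewrite (bigD1 j) //= big1 ?addr0 /D ?divnMDl // ?divn_small // ?addn0.
  by rewrite eqxx modnMDl modn_small.
by move=> k; rewrite -val_eqE /= => /negbTE->; rewrite mulop0.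
Qed.

End FullDualSystem.

(** * Traces with central values *)

Section CentralOperators.
Variables (R : pzRingType) (n : nat) (a : nat -> R) (E : nat -> R -> R) (w : R).
Hypothesis pR : prime_ring R.
Hypothesis sys : dual_system (@is_mulop R) n a E w.
Hypothesis sp : spans (@is_mulop R) n a setT.

Let Eop (i : 'I_n) : is_mulop (E i). Proof. by case: sys => _ Eo _; apply: Eo. Qed.
Let w0 : w != 0. Proof. by case: sys. Qed.

(** The sum of the [E j (S (a j))] is [w] times the trace of [S], so this is tr(ST) = tr(TS). In
    coordinates both sides are the same double sum, up to commuting factors by [dual_coef_comm2]. *)
Lemma dual_trace_comm (S T : R -> R) : is_mulop S -> is_mulop T ->
  \sum_(j < n) E j (S (T (a j))) = \sum_(j < n) E j (T (S (a j))).
Proof.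
have exp (S' T' : R -> R) y : is_mulop S' ->
    w * y * (\sum_(j < n) E j (S' (T' (a j)))) =
    \sum_(j < n) \sum_(i < n) E i (T' (a j)) * y * E j (S' (a i)).
  move=> Sop; rewrite mulr_sumr; apply: eq_bigr => j _.
  have [s sE] : is_mulop (E j \o S') by exact: is_mulop_comp (Eop j) Sop.
  have EE x : E j (S' x) = mulop s x by rewrite -sE.
  rewrite EE /mulop mulr_sumr.
  under [RHS]eq_bigr => i _ do rewrite EE /mulop mulr_sumr.
  rewrite exchange_big /=; apply: eq_bigr => p _.
  rewrite !mulrA -(mulrA w) (dual_expand_l sys sp) // mulr_suml.
  by apply: eq_bigr => i _; rewrite !mulrA.
move=> Sop Top; apply/eqP; rewrite -subr_eq0; apply/eqP.
apply: (prime_lcancel pR w0) => y; rewrite mulrBr (exp S T) // (exp T S) //.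
rewrite [X in X - _]exchange_big /=.
apply/eqP; rewrite subr_eq0; apply/eqP; apply: eq_bigr => i _.
by apply: eq_bigr => j _; rewrite (dual_coef_comm2 sys sp).
Qed.

(* In a central simple algebra, [E j x = tr(b_j x) w] for the basis [b] dual to
   [a] under the trace form; hence [Es j z = tr(w z) b_j] and
   [sum_j a_j x (Es j z) = tr(w z) tr(x)], a scalar. *)
Lemma central_operator (Es : nat -> R -> R) :
  (forall j : 'I_n, adjoint (E j) (Es j)) ->
  forall x z r, r * (\sum_(j < n) a j * x * Es j z) =
                (\sum_(j < n) a j * x * Es j z) * r.
Proof.
move=> adjE x z r; apply/eqP; rewrite -subr_eq0; apply/eqP.
rewrite mulr_sumr mulr_suml -sumrB.
(* As an operator in [z], the difference has as adjoint a difference of traces of two operators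
   composed in either order, namely [u |-> t * u] and [u |-> r * u * x]. *)
apply: (flip0 pR sys sp
  (f := fun z => \sum_(j < n) (E j (z * (r * a j * x)) - E j (r * z * (a j * x))))
  (g := fun z => \sum_(j < n) (r * (a j * x * Es j z) - a j * x * Es j z * r))).
  apply: adjoint_sum => j _; apply: adjointB.
    have := adjoint_argr (r * a j * x) (adjE j).
    by congr adjoint; apply/funext=> t; rewrite !mulrA.
  have := adjoint_argl r (adjoint_argr (a j * x) (adjE j)).
  by congr adjoint; apply/funext=> t; rewrite !mulrA.
move=> t; rewrite sumrB; apply/eqP; rewrite subr_eq0; apply/eqP.
rewrite (eq_bigr (fun j : 'I_n => E j (t * (r * a j * x)))) //.
rewrite (@dual_trace_comm (fun u => t * u) (fun u => r * u * x)).
- by apply: eq_bigr => j _; rewrite !mulrA.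
- exact/is_mulop_mull/is_mulop_id.
- exact/is_mulop_mulr/is_mulop_mull/is_mulop_id.
Qed.

(** Applying a central-valued [Om z] to [p * E j x * q] turns the denominator [w] of the coordinates
    into the central [c = Om z (p * w * q)]. What has to be excluded is that all these values
    vanish; in that case the traces of all operators followed by multiplication by [p * w * q]
    vanish, and the rank-one operator [E 0] gives a contradiction. *)
Lemma central_coordinates : exists (lam : nat -> R -> R) (c : R),
  [/\ c != 0, forall r, r * c = c * r,
     forall j : 'I_n, [/\ is_mulop (lam j),
       forall x r, r * lam j x = lam j x * r & lam j (a j) = c] &
     forall x, \sum_(j < n) lam j x * a j = c * x].
Proof.
have /choice[Es EsP] : forall j, exists g, (j < n)%N -> adjoint (E j) g.
  move=> j; case: (boolP (j < n)%N) => [jn|_]; last by exists id.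
  by have [g] := mulop_adjoint (Eop (Ordinal jn)); exists g.
have adjE (j : 'I_n) : adjoint (E j) (Es j) by apply: EsP.
pose Om z x := \sum_(j < n) a j * x * Es j z.
have Omop z : is_mulop (Om z).
  by apply: is_mulop_sum => j _; apply/is_mulop_mulr/is_mulop_mull/is_mulop_id.
have Omc z x r : r * Om z x = Om z x * r by apply: central_operator.
have [[z [p [q c0]]]|nex] := pselect (exists z p q, Om z (p * w * q) != 0).
  exists (fun j x => Om z (p * E j x * q)), (Om z (p * w * q)).
  have lop (j : 'I_n) : is_mulop (fun x => Om z (p * E j x * q)).
    by apply: (@is_mulop_comp _ (Om z)) => //; apply/is_mulop_mulr/is_mulop_mull.
  split=> // [j|x]; first by split=> //; have [_ _ ->] := sys; rewrite ?eqxx.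
  apply/eqP; rewrite -subr_eq0; apply/eqP.
  apply: (sp (T := fun x => \sum_(j < n) Om z (p * E j x * q) * a j -
     Om z (p * w * q) * x)) => //.
    apply: is_mulopB; last exact/is_mulop_mull/is_mulop_id.
    by apply: is_mulop_sum => j _; apply: is_mulop_mulr.
  move=> i ni; have [_ _ Ea] := sys.
  rewrite (bigD1 (Ordinal ni)) //= big1 ?addr0; last first.
    move=> j ji; rewrite Ea // ifN // mulr0 mul0r.
    by rewrite mulop0 // mul0r.
  by rewrite Ea // eqxx subrr.
(* Taking adjoints in [z] turns the vanishing of [Om] into that of the trace of
   [u |-> z * u * (p * w * q)]. *)
have tr0 z p q : \sum_(j < n) E j (z * (a j * (p * w * q))) = 0.
  apply: (flip0 pR sys sp (f := fun z => Om z (p * w * q))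
    (g := fun z => \sum_(j < n) E j (z * (a j * (p * w * q))))).
    apply/adjoint_sym/adjoint_sum => j _; exact: adjoint_argr (adjE j).
  by move=> t; apply: contrapT => /eqP tn; apply: nex; exists t, p, q.
case: n a E sys sp Eop adjE tr0 {Om Omop Omc nex} => [|n'] a' E' sys' sp' Eop' adjE tr0.
  have [/eqP[]] := pR; exact: (sp' id (@is_mulop_id R)).
have E0 z p q : E' 0%N (z * (w * p * w * q)) = 0.
  have [s sE] := Eop' ord0.
  have : \sum_(k <- s) \sum_(j < n'.+1)
      E' j (z * k.1 * (a' j * (k.2 * p * w * q))) = 0 by rewrite big1.
  rewrite exchange_big /=; move=> <-.
  (* The trace of [E' 0] followed by this multiplication: only [j = 0] contributes, because [E' 0]
     vanishes at the other [a' j]. *)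
  have: \sum_(j < n'.+1) E' j ((fun u => z * u * (p * w * q)) (E' 0%N (a' j))) =
        E' 0%N (z * (w * p * w * q)).
    rewrite (bigD1 ord0) //= big1 ?addr0; last first.
      move=> j j0; have [_ _ Ea] := sys'; rewrite Ea // eq_sym ifN // mulr0 mul0r.
      by rewrite mulop0.
    by have [_ _ Ea] := sys'; rewrite Ea //= !mulrA.
  move=> <-; apply: eq_bigr => j _; rewrite -mulop_sum //; congr (E' j _).
  rewrite {1}(_ : E' 0%N = mulop s) // /mulop mulr_sumr mulr_suml.
  by apply: eq_bigr => k _; rewrite !mulrA.
(* By [flip0] the adjoint [w * p * w * q * Es 0 z] of the operator in [E0] vanishes; primeness
   removes the two factors [w] in turn. *)
have F0 z : Es 0%N z = 0.
  apply: (prime_lcancel pR w0) => q; apply: (prime_lcancel pR w0) => p.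
  have := flip0 pR sys' sp' (adjoint_argr (w * p * w * q) (adjE ord0)).
  by move=> /(_ (fun z => E0 z p q) z); rewrite !mulrA.
have G0 := flip0 pR sys' sp' (adjoint_sym (adjE ord0)) F0.
have [_ _ Ea] := sys'; have := G0 (a' 0%N).
by rewrite Ea //= => /eqP; rewrite (negbTE w0).
Qed.

End CentralOperators.

Section CentralDualBasis.
Variable T : pzRingType.

(* At [c = 1] this says that [T] is Azumaya over its center [Z]: the [lam i]
   and [a i] are dual bases of the [Z]-module [T], whose trace ideal is [Z]. *)
Definition central_dual_basis (c : T) (I : finType) (a t : I -> T)
    (lam : I -> T -> T) :=
  [/\ forall i, is_mulop (lam i), forall i x r, r * lam i x = lam i x * r,
      forall x, \sum_i lam i x * a i = c * x & \sum_i lam i (t i) = c].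

End CentralDualBasis.

Lemma prime_central_dual_basis (R : pzRingType) d (W : seq (int * seq nat)) : prime_ring R ->
  right_noetherian R ->
  (forall p, p \in W -> (size p.2 <= d)%N) ->
  \sum_(p <- W | p.2 == iota 0 d) p.1 = 1 -> words_identity R W ->
  exists (c : R) (I : finType) (a t : I -> R) lam,
    [/\ c != 0, forall r, r * c = c * r & central_dual_basis c a t lam].
Proof.
move=> pR Rn Wd W1 W0.
have [T [z [Top Tfin Tz]]] := finite_rank_mulop pR Wd W1 W0.
have [G [w [Gop w0 [x Gx] Gw]]] := finite_rank_scalar pR Top Tfin Tz.
have [u [L [e [u0 se]]]] := scalar_mulop_corner pR Gop w0 Gx Gw.
have [V [L' [e' [VM V0 sV]]]] := finite_left_ideal pR Rn w0 u0 se.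
have [n [a [E [v [sys sp]]]]] := full_dual_system pR VM V0 sV.
have [lam [c [c0 cC lamP lamE]]] := central_coordinates pR sys sp.
have n0 : (0 < n)%N.
  rewrite lt0n; apply: contra_neqN c0 => /eqP n0.
  by have := lamE 1; rewrite mulr1 => <-; rewrite big1 // => -[i]; rewrite n0.
pose i0 := Ordinal n0.
(* One index suffices to reach [c] in the trace ideal: [lam i0 (a i0) = c]. *)
exists c, 'I_n, (fun i : 'I_n => a i), (fun i : 'I_n => if i == i0 then a i else 0),
  (fun i : 'I_n => lam i).
split=> //; split=> //.
- by move=> i; have [] := lamP i.
- by move=> i; have [] := lamP i.
rewrite (bigD1 i0) //= big1 ?addr0; first by have [_ _] := lamP i0.
by move=> i /negbTE->; have [lo _ _] := lamP i; apply: mulop0.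
Qed.

(** * Quotients and central localizations *)

Section QuotientRing.
Variables (R : pzRingType) (P : set R) (Pi : ideal P).

Definition quot_ring := quot_group Pi.1.
HB.instance Definition _ := GRing.Zmodule.on quot_ring.

Let pr : R -> quot_ring := quot_proj Pi.1.
Let prB : {morph pr : x y / x - y}. Proof. by move=> x y; rewrite /pr raddfB. Qed.
Let prD : {morph pr : x y / x + y}. Proof. by move=> x y; rewrite /pr raddfD. Qed.
Let prE x y : pr x = pr y <-> P (x - y). Proof. exact: quot_proj_eq. Qed.
Let prK u : pr (repr u) = u. Proof. by rewrite /pr /quot_proj reprK. Qed.

Definition quot_mul (u v : quot_ring) : quot_ring :=
  quot_proj Pi.1 (repr u * repr v).

Lemma quot_mulE x y : quot_mul (pr x) (pr y) = pr (x * y).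
Proof.
apply/prE; have /prE Px := prK (pr x); have /prE Py := prK (pr y).
set x' := repr _ in Px *; set y' := repr _ in Py *.
rewrite (_ : _ - _ = (x' - x) * y' + x * (y' - y)).
  by apply: subgroupD; [exact: Pi.1| have [] := Pi.2 _ y' Px |have [] := Pi.2 _ x Py].
by rewrite mulrBl mulrBr addrA subrK.
Qed.

Fact quot_mulA : associative quot_mul.
Proof.
by move=> u v w; rewrite -[u]prK -[v]prK -[w]prK !quot_mulE mulrA.
Qed.
Fact quot_mul1r : left_id (pr 1) quot_mul.
Proof. by move=> u; rewrite -[u]prK quot_mulE mul1r. Qed.
Fact quot_mulr1 : right_id (pr 1) quot_mul.
Proof. by move=> u; rewrite -[u]prK quot_mulE mulr1. Qed.
Fact quot_mulDl : left_distributive quot_mul +%R.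
Proof.
by move=> u v w; rewrite -[u]prK -[v]prK -[w]prK -prD !quot_mulE mulrDl prD.
Qed.
Fact quot_mulDr : right_distributive quot_mul +%R.
Proof.
by move=> u v w; rewrite -[u]prK -[v]prK -[w]prK -prD !quot_mulE mulrDr prD.
Qed.
HB.instance Definition _ := GRing.Zmodule_isPzRing.Build quot_ring
  quot_mulA quot_mul1r quot_mulr1 quot_mulDl quot_mulDr.

Definition quot_ring_proj (x : R) : quot_ring := quot_proj Pi.1 x.
Fact quot_ring_proj_zmod : zmod_morphism quot_ring_proj. Proof. exact: prB. Qed.
Fact quot_ring_proj_monoid : monoid_morphism quot_ring_proj.
Proof. by split=> // x y; apply: (esym (quot_mulE x y)). Qed.
HB.instance Definition _ := GRing.isZmodMorphism.Build R quot_ring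
  quot_ring_proj quot_ring_proj_zmod.
HB.instance Definition _ := GRing.isMonoidMorphism.Build R quot_ring
  quot_ring_proj quot_ring_proj_monoid.

Lemma quot_ring_proj_surj u : exists x, quot_ring_proj x = u.
Proof. by exists (repr u); apply: prK. Qed.

Lemma quot_ring_proj0 x : quot_ring_proj x = 0 <-> P x.
Proof.
by rewrite -(raddf0 quot_ring_proj) (prE x 0) subr0.
Qed.

End QuotientRing.

Section Localization.
Variables (S : pzRingType) (c : S).
Hypotheses (cC : forall x, c * x = x * c) (c_reg : forall x, x * c = 0 -> x = 0).

Let cXC n x : c ^+ n * x = x * c ^+ n.
Proof.
by elim: n => [|n IH]; rewrite ?expr0 ?mul1r ?mulr1 // exprS -mulrA IH mulrA cC mulrA.
Qed.

Let cXK n x y : x * c ^+ n = y * c ^+ n -> x = y.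
Proof.
elim: n => [|n IH]; first by rewrite expr0 !mulr1.
rewrite exprSr !mulrA => /eqP; rewrite -subr_eq0 -mulrBl => /eqP/c_reg/eqP.
by rewrite subr_eq0 => /eqP/IH.
Qed.

(** Transitivity of this relation, without an auxiliary power of [c], rests on the regularity of
    [c]. *)
Definition frac_equiv (p q : S * nat) := p.1 * c ^+ q.2 == q.1 * c ^+ p.2.

Fact frac_equiv_refl : reflexive frac_equiv. Proof. by move=> p; apply: eqxx. Qed.
Fact frac_equiv_sym : symmetric frac_equiv. Proof. by move=> p q; apply: eq_sym. Qed.
Fact frac_equiv_trans : transitive frac_equiv.
Proof.
move=> [y m] [x n] [z k]; rewrite /frac_equiv /= => /eqP xy /eqP yz.
apply/eqP/(@cXK m); rewrite -mulrA cXC mulrA xy -mulrA cXC mulrA yz.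
by rewrite -!mulrA; congr (_ * _); rewrite cXC.
Qed.

Canonical frac_equiv_rel :=
  EquivRel frac_equiv frac_equiv_refl frac_equiv_sym frac_equiv_trans.

Definition loc_ring : Type := {eq_quot frac_equiv}%qT.
HB.instance Definition _ := Choice.on loc_ring.

(* [frac x n] stands for [x / c ^ n]. *)
Definition frac (x : S) (n : nat) : loc_ring := (\pi_({eq_quot frac_equiv}) (x, n))%qT.

Lemma frac_eq x n y m : frac x n = frac y m <-> x * c ^+ m = y * c ^+ n.
Proof.
split=> [/eqP|xy]; last apply/eqP.
  by rewrite /frac eqmodE => /eqP.
by rewrite /frac eqmodE; apply/eqP.
Qed.

Let fracK (u : loc_ring) : frac (repr u : S * nat).1 (repr u : S * nat).2 = u.
Proof. by rewrite /frac -surjective_pairing reprK. Qed.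

Lemma fracP (u : loc_ring) : exists x n, u = frac x n.
Proof. by exists (repr u : S * nat).1, (repr u : S * nat).2; rewrite fracK. Qed.

Let fracX x n y m : x * c ^+ n = y * c ^+ m ->
  forall k, x * c ^+ (n + k) = y * c ^+ (m + k).
Proof. by move=> xy k; rewrite !exprD !mulrA xy. Qed.

Definition loc_add (u v : loc_ring) : loc_ring :=
  let p := repr u : S * nat in let q := repr v : S * nat in
  frac (p.1 * c ^+ q.2 + q.1 * c ^+ p.2) (p.2 + q.2).
Definition loc_mul (u v : loc_ring) : loc_ring :=
  let p := repr u : S * nat in let q := repr v : S * nat in
  frac (p.1 * q.1) (p.2 + q.2).
Definition loc_opp (u : loc_ring) : loc_ring :=
  let p := repr u : S * nat in frac (- p.1) p.2.

Lemma loc_addE x n y m :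
  loc_add (frac x n) (frac y m) = frac (x * c ^+ m + y * c ^+ n) (n + m).
Proof.
apply/frac_eq; have /frac_eq := fracK (frac x n); have /frac_eq := fracK (frac y m).
rewrite /loc_add; set p := (repr (frac x n) : S * nat).
set q := (repr (frac y m) : S * nat); move=> /fracX yy /fracX xx /=.
rewrite !mulrDl -!mulrA -!exprD; congr (_ + _).
  have -> : (q.2 + (n + m) = n + (q.2 + m))%N by lia.
  by rewrite xx; congr (_ * _ ^+ _); lia.
have -> : (p.2 + (n + m) = m + (p.2 + n))%N by lia.
by rewrite yy; congr (_ * _ ^+ _); lia.
Qed.

Lemma loc_mulE x n y m : loc_mul (frac x n) (frac y m) = frac (x * y) (n + m).
Proof.
apply/frac_eq; have /frac_eq := fracK (frac x n); have /frac_eq := fracK (frac y m).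
rewrite /loc_mul; set p := (repr (frac x n) : S * nat).
set q := (repr (frac y m) : S * nat); move=> yy xx /=.
rewrite addnC exprD mulrA -(mulrA p.1) yy -(mulrA p.1) -(cXC n) (mulrA p.1) xx.
by rewrite -!mulrA (mulrA (c ^+ p.2)) cXC -!mulrA -exprD.
Qed.

Lemma loc_oppE x n : loc_opp (frac x n) = frac (- x) n.
Proof.
apply/frac_eq; have /frac_eq := fracK (frac x n).
by move: (repr _ : S * nat) => [x' n'] /= xx; rewrite !mulNr xx.
Qed.

Fact loc_addA : associative loc_add.
Proof.
move=> u v w; have [x [n ->]] := fracP u; have [y [m ->]] := fracP v.
have [z [k ->]] := fracP w; rewrite !loc_addE addnA; congr frac.
rewrite !mulrDl addrA -!mulrA -!exprD.
by congr (_ + _ * _ ^+ _ + _ * _ ^+ _); lia.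
Qed.
Fact loc_addC : commutative loc_add.
Proof.
move=> u v; have [x [n ->]] := fracP u; have [y [m ->]] := fracP v.
by rewrite !loc_addE addrC addnC.
Qed.
Fact loc_add0 : left_id (frac 0 0) loc_add.
Proof.
by move=> u; have [x [n ->]] := fracP u; rewrite loc_addE mul0r add0r expr0 mulr1.
Qed.
Fact loc_addN : left_inverse (frac 0 0) loc_opp loc_add.
Proof.
move=> u; have [x [n ->]] := fracP u; rewrite loc_oppE loc_addE.
by apply/frac_eq; rewrite mulNr addNr !mul0r.
Qed.
Fact loc_mulA : associative loc_mul.
Proof.
move=> u v w; have [x [n ->]] := fracP u; have [y [m ->]] := fracP v.
by have [z [k ->]] := fracP w; rewrite !loc_mulE addnA mulrA.
Qed.
Fact loc_mul1r : left_id (frac 1 0) loc_mul.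
Proof. by move=> u; have [x [n ->]] := fracP u; rewrite loc_mulE mul1r. Qed.
Fact loc_mulr1 : right_id (frac 1 0) loc_mul.
Proof. by move=> u; have [x [n ->]] := fracP u; rewrite loc_mulE mulr1 addn0. Qed.
Fact loc_mulDl : left_distributive loc_mul loc_add.
Proof.
move=> u v w; have [x [n ->]] := fracP u; have [y [m ->]] := fracP v.
have [z [k ->]] := fracP w; rewrite !(loc_addE, loc_mulE); apply/frac_eq.
rewrite !mulrDl -!mulrA (mulrA (c ^+ m) z) (mulrA (c ^+ n) z) (cXC m z) (cXC n z).
by rewrite -!mulrA -!exprD; congr (_ * (_ * _ ^+ _) + _ * (_ * _ ^+ _)); lia.
Qed.
Fact loc_mulDr : right_distributive loc_mul loc_add.
Proof.
move=> u v w; have [x [n ->]] := fracP u; have [y [m ->]] := fracP v.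
have [z [k ->]] := fracP w; rewrite !(loc_addE, loc_mulE); apply/frac_eq.
rewrite !mulrDr !mulrDl -!mulrA -!exprD.
by congr (_ * (_ * _ ^+ _) + _ * (_ * _ ^+ _)); lia.
Qed.
HB.instance Definition _ := GRing.isPzRing.Build loc_ring
  loc_addA loc_addC loc_add0 loc_addN
  loc_mulA loc_mul1r loc_mulr1 loc_mulDl loc_mulDr.

Definition loc_embed (x : S) : loc_ring := frac x 0.
Fact loc_embed_zmod : zmod_morphism loc_embed.
Proof.
move=> x y; rewrite /GRing.add /GRing.opp /= /loc_embed loc_oppE loc_addE.
by rewrite !expr0 !mulr1.
Qed.
Fact loc_embed_monoid : monoid_morphism loc_embed.
Proof. by split=> // x y; rewrite /GRing.mul /= loc_mulE. Qed.
HB.instance Definition _ := GRing.isZmodMorphism.Build S loc_ring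
  loc_embed loc_embed_zmod.
HB.instance Definition _ := GRing.isMonoidMorphism.Build S loc_ring
  loc_embed loc_embed_monoid.

Definition loc_inv : loc_ring := frac 1 1.

Lemma loc_invC u : loc_inv * u = u * loc_inv.
Proof.
have [x [n ->]] := fracP u; rewrite /GRing.mul /= !loc_mulE.
by rewrite mul1r mulr1 addnC.
Qed.

Lemma loc_invK : loc_inv * loc_embed c = 1.
Proof. by rewrite /GRing.mul /= loc_mulE; apply/frac_eq; rewrite !mul1r expr0 mulr1. Qed.

Lemma loc_ringP u : exists x n, u = loc_embed x * loc_inv ^+ n.
Proof.
have [x [n ->]] := fracP u; exists x, n; elim: n => [|n IH].
  by rewrite expr0 mulr1.
rewrite exprSr mulrA -IH /GRing.mul /= loc_mulE mulr1 addn1 //.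
Qed.

Lemma loc_embed0 x : loc_embed x = 0 <-> x = 0.
Proof. by split=> [/frac_eq|->]; rewrite ?rmorph0 // expr0 mulr1 mul0r. Qed.

End Localization.

(** * Ideals of a ring and of its center *)

Section Ideals.
Variable R : pzRingType.
Implicit Types (I J P : set R).

Lemma ideal_absorbl I r x : ideal I -> I x -> I (r * x).
Proof. by move=> Ii Ix; have [] := Ii.2 x r Ix. Qed.

Lemma ideal_absorbr I r x : ideal I -> I x -> I (x * r).
Proof. by move=> Ii Ix; have [] := Ii.2 x r Ix. Qed.

Lemma ideal_sum I (K : finType) (F : K -> R) : ideal I ->
  (forall k, I (F k)) -> I (\sum_k F k).
Proof.
move=> Ii IF; apply: (big_ind I) => //; first exact: Ii.1.1.
by move=> x y; apply: subgroupD Ii.1.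
Qed.

Lemma ideal_mulop I f x : ideal I -> is_mulop f -> I x -> I (f x).
Proof.
move=> Ii [s ->] Ix; apply: (big_ind I); first exact: Ii.1.1.
  by move=> y z; apply: subgroupD Ii.1.
by move=> p _; apply: ideal_absorbr => //; apply: ideal_absorbl.
Qed.

Lemma ideal_setT : ideal [set: R].
Proof. by []. Qed.

Lemma ideal1 I : ideal I -> I 1 -> I = setT.
Proof.
move=> Ii I1; apply/seteqP; split=> // x _.
by rewrite -[x]mulr1; apply: ideal_absorbl.
Qed.

Lemma ideal_mul_subset I J P : ideal P ->
  (forall x y, I x -> J y -> P (x * y)) -> ideal_mul I J `<=` P.
Proof.
move=> Pi IJP x; apply; split; first exact: Pi.1.
by move=> _ [a Ia [b Jb <-]]; apply: IJP.
Qed.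

Lemma mem_ideal_mul I J x y : I x -> J y -> ideal_mul I J (x * y).
Proof. by move=> Ix Jy G [_]; apply; exists x => //; exists y. Qed.

Lemma ideal_mul_ideal I J : ideal I -> ideal J -> ideal (ideal_mul I J).
Proof.
move=> Ii Ji; have Sg := smallest_subgroup [set x * y | x in I & y in J].
split=> // x r IJx; split.
  apply: (IJx [set z | ideal_mul I J (r * z)]); split.
    split; first by rewrite /= mulr0; apply: Sg.1.
    by move=> u v /= Hu Hv; rewrite mulrBr; apply: Sg.2.
  move=> _ [a Ia [b Jb <-]] /=; rewrite mulrA; apply: mem_ideal_mul => //.
  exact: ideal_absorbl.
apply: (IJx [set z | ideal_mul I J (z * r)]); split.
  split; first by rewrite /= mul0r; apply: Sg.1.
  by move=> u v /= Hu Hv; rewrite mulrBl; apply: Sg.2.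
move=> _ [a Ia [b Jb <-]] /=; rewrite -mulrA; apply: mem_ideal_mul => //.
exact: ideal_absorbr.
Qed.

(** The [v] with [x R v] in [P] form an ideal, and so do the [u] with [u R v] in [P]; hence the
    condition spreads from [x] and [y] to the ideals they generate. *)
Lemma prime_ideal_elt P x y : prime_ideal P ->
  (forall r, P (x * r * y)) -> P x \/ P y.
Proof.
move=> [Pi _ Pp] xy.
pose g z := smallest (@ideal R) [set z].
have gz z : g z z by move=> J [_]; apply.
have [|gx|gy] := Pp (g x) (g y) (@smallest_ideal _ _) (@smallest_ideal _ _).
- apply: ideal_mul_subset => // u v gu gv.
  have H1 : forall r, P (x * r * v).
    apply: (gv [set v | forall r, P (x * r * v)]); split; last by move=> _ ->.
    split; [split|] => [r|a b Ha Hb r|a b Ha].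
    - by rewrite mulr0; apply: Pi.1.1.
    - by rewrite mulrBr; apply: Pi.1.2.
    split=> r; first by rewrite !mulrA -(mulrA x); apply: Ha.
    by rewrite mulrA; apply: ideal_absorbr.
  suff H2 : forall r, P (u * r * v) by rewrite -[u]mulr1; apply: H2.
  apply: (gu [set u | forall r, P (u * r * v)]); split; last by move=> _ ->.
  split; [split|] => [r|a b Ha Hb r|a b Ha].
  - by rewrite !mul0r; apply: Pi.1.1.
  - by rewrite !mulrBl; apply: Pi.1.2.
  split=> r; first by rewrite -!mulrA; apply: ideal_absorbl; rewrite ?mulrA.
  by rewrite -(mulrA a); apply: Ha.
- by left; apply: gx.
- by right; apply: gy.
Qed.

End Ideals.

Section ContractionExtension.
Variable R : pzRingType.
Notation Z := (center R).
Implicit Types (I : set R) (J : set Z).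

Lemma center_valC (z : Z) x : center_val z * x = x * center_val z.
Proof. by case: z => z /= /centralP. Qed.

Lemma center_val1 : center_val (1 : Z) = 1.
Proof. exact: (rmorph1 (val : Z -> R)). Qed.
Lemma center_val0 : center_val (0 : Z) = 0.
Proof. exact: (rmorph0 (val : Z -> R)). Qed.
Lemma center_valB (x y : Z) : center_val (x - y) = center_val x - center_val y.
Proof. exact: (rmorphB (val : Z -> R)). Qed.
Lemma center_valD (x y : Z) : center_val (x + y) = center_val x + center_val y.
Proof. exact: (rmorphD (val : Z -> R)). Qed.
Lemma center_valM (x y : Z) : center_val (x * y) = center_val x * center_val y.
Proof. exact: (rmorphM (val : Z -> R)). Qed.

Lemma contraction_ideal I : ideal I -> ideal (contraction I).
Proof.
move=> Ii; split; [split|] => [|x y|x r]; rewrite /contraction /=.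
- exact: Ii.1.1.
- exact: Ii.1.2.
exact: Ii.2.
Qed.

Lemma mem_extension J z x : J z -> extension J (center_val z * x).
Proof. by move=> Jz G [_]; apply; exists z => //; exists x. Qed.

Lemma extension_min J (G : set R) : additive_subgroup G ->
  (forall z x, J z -> G (center_val z * x)) -> extension J `<=` G.
Proof.
move=> Gg JG u; apply; split=> // _ [z Jz [x _ <-]]; exact: JG.
Qed.

Lemma extension_ideal J : ideal (extension J).
Proof.
have Eg := smallest_subgroup [set center_val z * x | z in J & x in setT].
split=> // x r Ex; split.
  apply: (extension_min (G := [set y | extension J (r * y)])) Ex.
    split; first by rewrite /= mulr0; apply: Eg.1.
    by move=> u v /= Hu Hv; rewrite mulrBr; apply: Eg.2.
  by move=> z y Jz /=; rewrite mulrA -center_valC -mulrA; exact: mem_extension.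
apply: (extension_min (G := [set y | extension J (y * r)])) Ex.
  split; first by rewrite /= mul0r; apply: Eg.1.
  by move=> u v /= Hu Hv; rewrite mulrBl; apply: Eg.2.
by move=> z y Jz /=; rewrite -mulrA; exact: mem_extension.
Qed.

Lemma extensionS J J' : J `<=` J' -> extension J `<=` extension J'.
Proof.
move=> JJ; apply: extension_min; first exact: (extension_ideal _).1.
by move=> z x /JJ Jz; exact: mem_extension.
Qed.

Lemma extension_ideal_mul J J' : ideal J -> ideal J' ->
  extension (ideal_mul J J') = ideal_mul (extension J) (extension J').
Proof.
move=> Ji Ji'; have Mi := ideal_mul_ideal (extension_ideal J) (extension_ideal J').
apply/seteqP; split.
  apply: extension_min; first exact: Mi.1.
  move=> z x JJz; apply: (ideal_absorbr _ Mi).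
  apply: (JJz [set z | ideal_mul (extension J) (extension J') (center_val z)]).
  split; first split.
  - by rewrite /= ?center_val0; apply: Mi.1.1.
  - by move=> u v; rewrite /= ?center_valB; apply: Mi.1.2.
  move=> _ [u Ju [v Jv <-]] /=; rewrite ?center_valM -[center_val u]mulr1.
  rewrite -[center_val v]mulr1; apply: mem_ideal_mul; exact: mem_extension.
have Ei := extension_ideal (ideal_mul J J').
apply: ideal_mul_subset => // u v Ju Jv; move: v Jv.
apply: extension_min => [|z' x' Jz'].
  split; first by rewrite mulr0; apply: Ei.1.1.
  by move=> x y Hx Hy; rewrite mulrBr; apply: Ei.1.2.
apply: (extension_min (G := [set u |
  extension (ideal_mul J J') (u * (center_val z' * x'))])) Ju.
  split; first by rewrite /= mul0r; apply: Ei.1.1.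
  by move=> x y /= Hx Hy; rewrite mulrBl; apply: Ei.1.2.
move=> z x Jz /=; rewrite mulrA -(mulrA (center_val z)) -center_valC mulrA.
rewrite -center_valM -(mulrA (center_val (z * z'))).
exact: mem_extension (mem_ideal_mul Jz Jz').
Qed.

(** Multiplication operators preserve ideals, so for [x] in [I] the coefficients of x = sum lam_k(x)
    a_k lie in the contraction of [I]. Conversely the [lam k] are linear over the center and map
    [extension J] into [J]; a central z in [extension J] equals sum lam_k(z t_k), hence is in
    [J]. *)
Lemma central_dual_basis_ideally_commutative (K : finType) (a t : K -> R) lam :
  central_dual_basis 1 a t lam -> ideally_commutative R.
Proof.
move=> [lo lC lE lt].
have EC I : ideal I -> extension (contraction I) = I.
  move=> Ii; apply/seteqP; split.
    apply: extension_min; first exact: Ii.1.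
    by move=> z x Iz; apply: ideal_absorbr.
  move=> x Ix; rewrite -[x]mul1r -lE.
  apply: ideal_sum => [|k]; first exact: extension_ideal.
  have lc : lam k x \in @central R by apply/centralP => r; rewrite lC.
  apply: (@mem_extension _ (Center lc)); rewrite /contraction /=.
  exact: (ideal_mulop Ii (lo k) Ix).
have CE J : ideal J -> contraction (extension J) = J.
  move=> Ji; apply/seteqP; split=> z; last first.
    by move=> Jz; rewrite /contraction /= -[center_val z]mulr1; exact: mem_extension.
  move=> Ez.
  have lamJ k x : extension J x -> exists2 y, J y & center_val y = lam k x.
    apply: (extension_min (G := [set x | exists2 y, J y & center_val y = lam k x])).
      split; first by exists 0; [exact: Ji.1.1 | rewrite center_val0 mulop0].
      move=> u v [y Jy yE] [y' Jy' yE']; exists (y - y'); first exact: Ji.1.2.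
      by rewrite ?center_valB yE yE' is_mulop_additive.
    move=> u v Ju; have lc : lam k v \in @central R by apply/centralP => r; rewrite lC.
    exists (u * Center lc); first exact: ideal_absorbr.
    rewrite ?center_valM /=; have [s ->] := lo k; rewrite /mulop mulr_sumr.
    by apply: eq_bigr => p _; rewrite !mulrA (center_valC u p.1).
  have /choice[y yP] : forall k, exists y, J y /\ center_val y = lam k (center_val z * t k).
    move=> k; have [|y] := lamJ k (center_val z * t k); last by exists y.
    exact: ideal_absorbr (extension_ideal J) Ez.
  suff -> : z = \sum_k y k by apply: ideal_sum => // k; have [] := yP k.
  apply: val_inj; transitivity (\sum_k center_val (y k)).
  2: exact: (esym (raddf_sum (val : Z -> R) _ _ _)).
  rewrite -[LHS]mulr1 -lt mulr_sumr.
  apply: eq_bigr => k _; have [_ ->] := yP k.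
  have [s ->] := lo k; rewrite /mulop mulr_sumr.
  by apply: eq_bigr => p _; rewrite !mulrA (center_valC z p.1).
split=> // [I I' Ii Ii'|]; last exact: extension_ideal_mul.
have Ci := contraction_ideal Ii; have Ci' := contraction_ideal Ii'.
by rewrite -{1}(EC I Ii) -{1}(EC I' Ii') -extension_ideal_mul // CE //;
  apply: ideal_mul_ideal.
Qed.

Hypothesis Ric : ideally_commutative R.

Lemma extension_prime J : prime_ideal J -> prime_ideal (extension J).
Proof.
case: Ric => EC CE CM _ [Ji J1 Jp]; split; first exact: extension_ideal.
  by move=> E1; apply: J1; rewrite -(CE J Ji) /contraction /= ?center_val1.
move=> I I' Ii Ii' II.
have [|||IJ|IJ] := Jp (contraction I) (contraction I').
- exact: contraction_ideal.
- exact: contraction_ideal.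
- by rewrite -CM // -[X in _ `<=` X](CE J Ji) => z; apply: II.
- by left; rewrite -(EC I Ii); apply: extensionS.
- by right; rewrite -(EC I' Ii'); apply: extensionS.
Qed.

Lemma contraction_prime I : prime_ideal I -> prime_ideal (contraction I).
Proof.
case: Ric => EC CE _ EM [Ii I1 Ip]; split; first exact: contraction_ideal.
  by rewrite /contraction /= ?center_val1.
move=> J J' Ji Ji' JJ.
have [|||EI|EI] := Ip (extension J) (extension J').
- exact: extension_ideal.
- exact: extension_ideal.
- by rewrite -EM // -(EC I Ii); apply: extensionS.
- by left; rewrite -(CE J Ji) => z; apply: EI.
- by right; rewrite -(CE J' Ji') => z; apply: EI.
Qed.

Lemma extension_maximal J : maximal_ideal J -> maximal_ideal (extension J).
Proof.
case: Ric => EC CE _ _ [Ji J1 Jm]; split; first exact: extension_ideal.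
  by move=> E1; apply: J1; rewrite -(CE J Ji) /contraction /= ?center_val1.
move=> I Ii EI.
have [||IJ|IT] := Jm (contraction I).
- exact: contraction_ideal.
- by rewrite -(CE J Ji) => z; apply: EI.
- by left; rewrite -IJ EC.
- right; apply: ideal1 => //; have : [set: Z] 1 by [].
  by rewrite -IT /contraction /= ?center_val1.
Qed.

Lemma contraction_maximal I : maximal_ideal I -> maximal_ideal (contraction I).
Proof.
case: Ric => EC CE _ _ [Ii I1 Im]; split; first exact: contraction_ideal.
  by rewrite /contraction /= ?center_val1.
move=> J Ji IJ.
have [||EI|ET] := Im (extension J).
- exact: extension_ideal.
- by rewrite -(EC I Ii); apply: extensionS.
- by left; rewrite -EI CE.
- by right; rewrite -(CE J Ji) ET.
Qed.

Lemma center_right_noetherian : right_noetherian R -> right_noetherian Z.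
Proof.
case: Ric => _ CE _ _ Rn J Jr Jc.
have Ji n : ideal (J n).
  split; first by have [] := Jr n.
  by move=> x r Jx; rewrite (mulrC r); split; have [_] := Jr n; apply.
have [||n nP] := Rn (fun n => extension (J n)).
- by move=> n; have [Eg EM] := extension_ideal (J n); split=> // x r /(EM _ r)[].
- by move=> n; apply: extensionS.
by exists n => m /nP E; rewrite -(CE (J m)) // E CE.
Qed.

End ContractionExtension.

(** * Primes of a localized prime quotient *)

Section SurjectiveMorphism.
Variables (R S : pzRingType) (f : {rmorphism R -> S}).

Lemma preimage_ideal J : ideal J -> ideal (f @^-1` J).
Proof.
move=> Ji; split; [split|] => [|x y|x r] /=.
- by rewrite rmorph0; apply: Ji.1.1.
- by rewrite rmorphB; apply: Ji.1.2.
- by rewrite !rmorphM; apply: Ji.2.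
Qed.

Hypothesis f_surj : forall s, exists r, f r = s.

Lemma preimage_inj (K K' : set S) : f @^-1` K = f @^-1` K' -> K = K'.
Proof.
move=> E; apply/seteqP; split=> s; have [x <-] := f_surj s => Kx.
  by rewrite -[K' _]/((f @^-1` K') x) -E.
by rewrite -[K _]/((f @^-1` K) x) E.
Qed.

Lemma image_right_noetherian : right_noetherian R -> right_noetherian S.
Proof.
move=> Rn J Jr Jc; have [||n nP] := Rn (fun n => f @^-1` J n).
- move=> n; have [[J0 JB] JM] := Jr n; split; first split.
  + by rewrite /= rmorph0.
  + by move=> x y; rewrite /= rmorphB; apply: JB.
  + by move=> x r; rewrite /= rmorphM; apply: JM.
- by move=> n x; apply: Jc.
by exists n => m /nP; apply: preimage_inj.
Qed.

Lemma image_ideal J : ideal J -> ideal (f @` J).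
Proof.
move=> Ji; split; [split|].
- by exists 0; [exact: Ji.1.1 | rewrite rmorph0].
- move=> _ _ [x Jx <-] [y Jy <-]; exists (x - y); last by rewrite rmorphB.
  exact: Ji.1.2.
move=> _ s [x Jx <-]; have [r <-] := f_surj s; rewrite -!rmorphM.
by split; [exists (r * x) | exists (x * r)] => //; have [] := Ji.2 x r Jx.
Qed.

Lemma preimage_image J : additive_subgroup J -> (forall x, f x = 0 -> J x) ->
  f @^-1` (f @` J) = J.
Proof.
move=> Jg kJ; apply/seteqP; split=> [x [y Jy fyx]|x Jx]; last by exists x.
rewrite -[x](subrK y); apply: subgroupD => //; apply: kJ.
by rewrite rmorphB fyx subrr.
Qed.

Lemma prime_ideal_of_elt (P : set R) : ideal P -> ~ P 1 ->
  (forall x y, (forall r, P (x * r * y)) -> P x \/ P y) -> prime_ideal P.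
Proof.
move=> Pi P1 Pe; split=> // I J Ii Ji IJP.
apply: contrapT => /not_orP[/existsNP[x /not_implyP[Ix Px]]].
move=> /existsNP[y /not_implyP[Jy Py]]; have [r||//] := Pe x y; last by [].
exact: (IJP _ (mem_ideal_mul (ideal_absorbr r Ii Ix) Jy)).
Qed.

End SurjectiveMorphism.

Section SurjectivePreimages.
Variables (R S : pzRingType) (f : {rmorphism R -> S}).
Hypothesis f_surj : forall s, exists r, f r = s.

Lemma preimage_prime Q : prime_ideal Q -> prime_ideal (f @^-1` Q).
Proof.
move=> Qp; have [Qi Q1 _] := Qp.
apply: prime_ideal_of_elt => //; first exact: preimage_ideal.
  by rewrite /= rmorph1.
move=> x y xy; apply: (prime_ideal_elt Qp) => s; have [r <-] := f_surj s.
by rewrite -!rmorphM; apply: xy.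
Qed.

Lemma image_prime P : prime_ideal P -> (forall x, f x = 0 -> P x) ->
  prime_ideal (f @` P).
Proof.
move=> Pp kP; have [Pi P1 _] := Pp; have E := preimage_image Pi.1 kP.
apply: prime_ideal_of_elt => //; first exact: image_ideal.
  by move=> fP1; apply: P1; rewrite -E /= rmorph1.
move=> s t st; have [x xs] := f_surj s; have [y yt] := f_surj t.
have [r|Px|Py] := @prime_ideal_elt _ P x y Pp.
- by rewrite -E /= !rmorphM xs yt; apply: st.
- by left; exists x.
- by right; exists y.
Qed.

Lemma preimage_maximal Q : maximal_ideal Q -> maximal_ideal (f @^-1` Q).
Proof.
move=> [Qi Q1 Qm]; split; first exact: preimage_ideal.
  by rewrite /= rmorph1.
move=> J Ji QJ; have kJ x : f x = 0 -> J x.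
  by move=> fx; apply: QJ; rewrite /= fx; apply: Qi.1.1.
have E := preimage_image Ji.1 kJ.
have [||fE|fT] := Qm (f @` J); first exact: image_ideal.
- by move=> s; have [x <-] := f_surj s => Qx; exists x => //; apply: QJ.
- by left; rewrite -E fE.
- by right; rewrite -E fT.
Qed.

Lemma image_maximal P : maximal_ideal P -> (forall x, f x = 0 -> P x) ->
  maximal_ideal (f @` P).
Proof.
move=> [Pi P1 Pm] kP; have E := preimage_image Pi.1 kP.
split; first exact: image_ideal.
  by move=> fP1; apply: P1; rewrite -E /= rmorph1.
move=> J Ji PJ; have [||JE|JT] := Pm (f @^-1` J); first exact: preimage_ideal.
- by move=> x Px; apply: PJ; exists x.
- by left; apply: (preimage_inj f_surj); rewrite E.
- by right; apply: (preimage_inj f_surj); rewrite JT.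
Qed.

End SurjectivePreimages.

Section QuotientPrime.
Variables (R : pzRingType) (P : set R) (Pi : ideal P).

Lemma quot_ring_prime : prime_ideal P -> prime_ring (quot_ring Pi).
Proof.
move=> Pp; have [_ P1 _] := Pp; split.
  by apply/eqP => /(@quot_ring_proj0 _ _ Pi 1); apply: P1.
move=> u v; have [x <-] := quot_ring_proj_surj u; have [y <-] := quot_ring_proj_surj v.
move=> xy; have [r||] := @prime_ideal_elt _ P x y Pp.
- by apply/(quot_ring_proj0 Pi); rewrite !rmorphM; apply: xy.
- by move/(quot_ring_proj0 Pi); left.
- by move/(quot_ring_proj0 Pi); right.
Qed.

End QuotientPrime.

Lemma morph_mulop (R S : pzRingType) (f : {rmorphism R -> S}) s x :
  f (mulop s x) = mulop [seq (f p.1, f p.2) | p <- s] (f x).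
Proof.
by rewrite /mulop rmorph_sum big_map; apply: eq_bigr => p _; rewrite !rmorphM.
Qed.

(* The relations of a [central_dual_basis] of [R / P], lifted to [R]. *)
Definition dual_basis_mod (R : pzRingType) (P : set R) (c : R) (I : finType)
    (a t : I -> R) (s : I -> seq (R * R)) :=
  [/\ ~ P c, forall r, P (r * c - c * r),
      forall i x r, P (r * mulop (s i) x - mulop (s i) x * r),
      forall x, P (\sum_i mulop (s i) x * a i - c * x) &
      P (\sum_i mulop (s i) (t i) - c)].

Lemma prime_dual_basis_mod (R : pzRingType) (P : set R) : right_noetherian R ->
  PI_ring R -> prime_ideal P ->
  exists c I a t s, @dual_basis_mod R P c I a t s.
Proof.
move=> Rn RPI Pp; have [Pi P1 _] := Pp.
have [d [W [Wd W1 W0]]] := PI_words_identity RPI.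
pose f : {rmorphism R -> quot_ring Pi} := @quot_ring_proj R P Pi.
have fs : forall s, exists r, f r = s by exact: quot_ring_proj_surj.
have f0 x : f x = 0 -> P x by move/(quot_ring_proj0 Pi).
have fE x y : f x = f y -> P (x - y).
  by move=> xy; apply: f0; rewrite rmorphB xy subrr.
have [c' [I [a' [t' [lam [c0 cC [lo lC lE lt]]]]]]] :=
  prime_central_dual_basis (quot_ring_prime Pi Pp) (image_right_noetherian fs Rn)
    Wd W1 (words_identity_surj fs W0).
have [g gK] := choice fs.
have /choice[s sE] : forall i, exists s, lam i = mulop [seq (f p.1, f p.2) | p <- s].
  move=> i; have [s ->] := lo i; exists [seq (g p.1, g p.2) | p <- s].
  by rewrite -map_comp map_id_in // => -[u v] _ /=; rewrite !gK.
have lamE i x : f (mulop (s i) x) = lam i (f x) by rewrite morph_mulop -sE.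
exists (g c'), I, (g \o a'), (g \o t'), s; split.
- by move/(quot_ring_proj0 Pi); rewrite -/(f _) gK => /eqP; rewrite (negbTE c0).
- by move=> r; apply: fE; rewrite !rmorphM gK.
- by move=> i x r; apply: fE; rewrite !rmorphM lamE lC.
- move=> x; apply: fE; rewrite rmorph_sum rmorphM gK -lE; apply: eq_bigr => i _.
  by rewrite rmorphM lamE /= gK.
apply: fE; rewrite rmorph_sum gK -lt; apply: eq_bigr => i _.
by rewrite lamE /= gK.
Qed.

(* [B] is [(R / P)[1 / c]] via [f], with [ci] the inverse of [c]. *)
Definition localizes (R B : pzRingType) (f : {rmorphism R -> B}) (P : set R) c ci :=
  [/\ forall u : B, ci * u = u * ci, ci * f c = 1, forall x, f x = 0 <-> P x &
      forall u, exists x n, u = f x * ci ^+ n].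

Lemma localization_exists (R : pzRingType) (P : set R) (c : R) : prime_ideal P ->
  ~ P c -> (forall r, P (r * c - c * r)) ->
  exists (B : pzRingType) (f : {rmorphism R -> B}) ci, localizes f P c ci.
Proof.
move=> Pp Pc cC; have [Pi P1 _] := Pp.
pose f : {rmorphism R -> quot_ring Pi} := @quot_ring_proj R P Pi.
have fs : forall s, exists r, f r = s by exact: quot_ring_proj_surj.
have f0 x : f x = 0 <-> P x by exact: (quot_ring_proj0 Pi).
have fcC u : f c * u = u * f c.
  have [x <-] := fs u; apply/esym/eqP; rewrite -subr_eq0 -!rmorphM -rmorphB.
  exact/eqP/f0.
have pS := quot_ring_prime Pi Pp.
(* A nonzero central element of a prime ring is regular. *)
have fc_reg u : u * f c = 0 -> u = 0.
  move=> uc; apply: (prime_rcancel pS (w := f c)); first by apply/eqP => /f0.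
  by move=> y; rewrite -mulrA -fcC mulrA uc mul0r.
pose g : {rmorphism quot_ring Pi -> loc_ring fcC fc_reg} := @loc_embed _ _ fcC fc_reg.
exists (loc_ring fcC fc_reg), (g \o f : {rmorphism _ -> _}), (loc_inv fcC fc_reg).
split.
- exact: loc_invC.
- exact: loc_invK.
- by move=> x; rewrite -f0; apply: loc_embed0.
- move=> u; have [v [n ->]] := loc_ringP u; have [x <-] := fs v.
  by exists x, n.
Qed.

Section Localized.
Variables (R B : pzRingType) (f : {rmorphism R -> B}) (P : set R) (c : R) (ci : B).
Hypotheses (Pp : prime_ideal P) (loc : localizes f P c ci).

Let ciC n u : ci ^+ n * u = u * ci ^+ n.
Proof.
have [C _ _ _] := loc; elim: n => [|n IH]; first by rewrite expr0 mul1r mulr1.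
by rewrite exprS -mulrA IH mulrA C mulrA.
Qed.

Let ciK n : ci ^+ n * f c ^+ n = 1.
Proof.
have [C K _ _] := loc; elim: n => [|n IH]; first by rewrite !expr0 mulr1.
rewrite exprSr exprS mulrA -(mulrA _ ci) K mulr1.
by rewrite IH.
Qed.

Let fracP u : exists x n, u = f x * ci ^+ n. Proof. by case: loc. Qed.

Let fracM x n y m :
  (f x * ci ^+ n) * (f y * ci ^+ m) = f (x * y) * ci ^+ (n + m).
Proof. by rewrite -mulrA (mulrA (ci ^+ n)) ciC -mulrA -exprD mulrA -rmorphM. Qed.

Let fracS x n m : f (x * c ^+ m) * ci ^+ (m + n) = f x * ci ^+ n.
Proof.
by rewrite rmorphM rmorphXn -mulrA exprD (mulrA (f c ^+ m)) -(ciC m) ciK mul1r.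
Qed.

Lemma localized_right_noetherian : right_noetherian R -> right_noetherian B.
Proof.
move=> Rn J Jr Jc; have [||n nP] := Rn (fun n => f @^-1` J n).
- move=> n; have [[J0 JB] JM] := Jr n; split; first split.
  + by rewrite /= rmorph0.
  + by move=> x y; rewrite /= rmorphB; apply: JB.
  + by move=> x r; rewrite /= rmorphM; apply: JM.
- by move=> n x; apply: Jc.
have JE m x k : J m (f x * ci ^+ k) <-> (f @^-1` J m) x.
  have [_ JM] := Jr m; split=> [/JM H|/JM]; last exact.
  by have := H (f c ^+ k); rewrite -mulrA ciK mulr1.
exists n => m /nP E; apply/seteqP; split=> u; have [x [k ->]] := fracP u.
  by rewrite !JE E.
by rewrite !JE E.
Qed.

(** Multiplying the operators by [ci], the inverse of [c], normalizes the constant to 1. *)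
Lemma localized_central_dual_basis (I : finType) (a t : I -> R) s :
  dual_basis_mod P c a t s ->
  exists lam, central_dual_basis 1 (f \o a) (f \o t) lam.
Proof.
move=> [_ cC lC lE lt]; have [C K f0 _] := loc.
have fE x y : P (x - y) -> f x = f y.
  by move/f0/eqP; rewrite rmorphB subr_eq0 => /eqP.
pose lam i u := mulop [seq (f p.1, f p.2) | p <- s i] u * ci.
have lamE i x n : lam i (f x * ci ^+ n) = f (mulop (s i) x) * ci ^+ n.+1.
  rewrite /lam morph_mulop exprSr mulrA; congr (_ * _).
  rewrite /mulop mulr_suml; apply: eq_bigr => p _.
  by rewrite -!mulrA ciC.
exists lam; split.
- by move=> i; apply: is_mulop_mulr; exists [seq (f p.1, f p.2) | p <- s i].
- move=> i u v; have [x [n ->]] := fracP u; have [y [m ->]] := fracP v.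
  by rewrite lamE !fracM (fE _ _ (lC i x y)) addnC.
- move=> u; have [x [n ->]] := fracP u; rewrite mul1r.
  transitivity (f (\sum_i mulop (s i) x * a i) * ci ^+ n.+1).
    rewrite rmorph_sum mulr_suml; apply: eq_bigr => i _.
    by rewrite lamE rmorphM -!mulrA ciC.
  have /fE -> := lE x; rewrite rmorphM exprS !mulrA.
  have /fE := cC x; rewrite !rmorphM => <-.
  by rewrite -(mulrA (f x)) -C K mulr1.
transitivity (f (\sum_i mulop (s i) (t i)) * ci).
  rewrite rmorph_sum mulr_suml; apply: eq_bigr => i _ /=.
  by have := lamE i (t i) 0%N; rewrite expr0 mulr1 expr1.
by have /fE -> := lt; rewrite -C.
Qed.

Lemma localized_mem (K : set B) x n : ideal K ->
  K (f x * ci ^+ n) <-> (f @^-1` K) x.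
Proof.
move=> Ki; split=> [Kx|Kx]; last exact: ideal_absorbr.
by have := ideal_absorbr (f c ^+ n) Ki Kx; rewrite -mulrA ciK mulr1.
Qed.

Lemma localized_preimage_sub (K K' : set B) : ideal K -> ideal K' ->
  f @^-1` K `<=` f @^-1` K' -> K `<=` K'.
Proof.
move=> Ki Ki' KK u; have [x [n ->]] := fracP u.
by move=> /(localized_mem _ _ Ki)/KK/(localized_mem _ _ Ki').
Qed.

Lemma localized_preimage_inj (K K' : set B) : ideal K -> ideal K' ->
  f @^-1` K = f @^-1` K' -> K = K'.
Proof.
move=> Ki Ki' KK; apply/seteqP; split; apply: localized_preimage_sub => //;
  by rewrite KK.
Qed.

Lemma localized_preimage_prime Q : prime_ideal Q ->
  [/\ prime_ideal (f @^-1` Q), P `<=` f @^-1` Q & ~ (f @^-1` Q) c].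
Proof.
move=> Qp; have [Qi Q1 _] := Qp; have [C K f0 _] := loc; split.
- apply: prime_ideal_of_elt; first exact: preimage_ideal.
    by rewrite /= rmorph1.
  move=> x y xy; apply: (prime_ideal_elt Qp) => u; have [r [n ->]] := fracP u.
  by rewrite mulrA -mulrA ciC mulrA -!rmorphM; apply/(localized_mem _ _ Qi)/xy.
- by move=> x /f0 fx; rewrite /= fx; apply: Qi.1.1.
- by move=> Qc; apply: Q1; rewrite -K; apply: ideal_absorbl.
Qed.

Definition localized_extension (J : set R) : set B :=
  [set u | exists x n, J x /\ u = f x * ci ^+ n].

Lemma localized_extension_prime P' : prime_ideal P' -> P `<=` P' -> ~ P' c ->
  prime_ideal (localized_extension P') /\ f @^-1` (localized_extension P') = P'.
Proof.
move=> Pp' PP' Pc'; have [Pi' P1' _] := Pp'; have [C K f0 _] := loc.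
have cC r : P (r * c - c * r).
  have cK : f c * ci = 1 by rewrite -C.
  apply/f0/eqP; rewrite rmorphB !rmorphM subr_eq0; apply/eqP/esym.
  by rewrite -[LHS]mulr1 -K mulrA -(mulrA (f c)) -C mulrA cK mul1r.
(* [c] is central modulo [P], hence modulo [P'], and the prime [P'] avoids it. *)
have cP' n x : P' (x * c ^+ n) -> P' x.
  elim: n x => [|n IH] x; first by rewrite expr0 mulr1.
  rewrite exprS mulrA => /IH xc; have [r|//|//] := @prime_ideal_elt _ P' x c Pp'.
  have H := PP' _ (cC r); rewrite -mulrA.
  rewrite -[r * c](subrK (c * r)) mulrDr mulrA.
  by apply: subgroupD Pi'.1 _ _; [exact: ideal_absorbl | exact: ideal_absorbr].
have memP x n : localized_extension P' (f x * ci ^+ n) <-> P' x.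
  split=> [[y [m [Py E]]]|]; last by exists x, n.
  apply: (cP' m); suff H : P (x * c ^+ m - y * c ^+ n).
    rewrite -[x * _](subrK (y * c ^+ n)).
    by apply: subgroupD Pi'.1 _ _; [exact: PP' | exact: ideal_absorbr].
  apply/f0/eqP; rewrite rmorphB !rmorphM !rmorphXn subr_eq0; apply/eqP.
  have := congr1 (fun u => u * (f c ^+ n * f c ^+ m)) E.
  rewrite -!mulrA (mulrA (ci ^+ n)) ciK mul1r => ->.
  by rewrite -exprD addnC exprD (mulrA (ci ^+ m)) ciK mul1r.
have Ei : ideal (localized_extension P').
  split; [split|].
  - by exists 0, 0%N; split; [exact: Pi'.1.1 | rewrite rmorph0 mul0r].
  - move=> _ _ [x [n [Px ->]]] [y [m [Py ->]]].
    exists (x * c ^+ m - y * c ^+ n), (m + n)%N; split.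
      by apply: Pi'.1.2; apply: ideal_absorbr.
    by rewrite rmorphB mulrBl fracS addnC fracS.
  move=> _ u [x [n [Px ->]]]; have [y [m ->]] := fracP u; rewrite !fracM; split.
    by exists (y * x), (m + n)%N; split; first exact: ideal_absorbl.
  by exists (x * y), (n + m)%N; split; first exact: ideal_absorbr.
have pre : f @^-1` (localized_extension P') = P'.
  apply/seteqP; split=> x.
    by move=> H; apply/(memP x 0%N); rewrite expr0 mulr1.
  by move=> H; have /(memP x 0%N) := H; rewrite expr0 mulr1.
split=> //; apply: prime_ideal_of_elt => //.
  by move=> E1; apply: P1'; rewrite -pre /= rmorph1.
move=> u v; have [x [n ->]] := fracP u; have [y [m ->]] := fracP v => xy.
rewrite !memP; apply: (prime_ideal_elt Pp') => r; apply/(memP _ (n + 0 + m)%N).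
by have := xy (f r * ci ^+ 0); rewrite !fracM.
Qed.

End Localized.

(** * Stratification of the spectrum *)

(** Coincides with [jacobson] as soon as [Prim R = Max R]. *)
Definition maximally_jacobson (R : pzRingType) := forall P : set R,
  prime_ideal P -> exists F, F `<=` Max R /\ P = \bigcap_(Q in F) Q.

(** The conditions on [T] and [f] are those inherited by products, which is what the induction over
    closed sets of primes [X] requires. *)
Definition stratifies (R T : pzRingType) (f : {rmorphism R -> T})
    (X : set (set R)) :=
  [/\ right_noetherian T /\
        exists K a t lam, @central_dual_basis T 1 K a t lam,
      forall Q, prime_ideal Q -> prime_ideal (f @^-1` Q) /\ X (f @^-1` Q),
      forall P, prime_ideal P -> X P -> exists2 Q, prime_ideal Q & f @^-1` Q = P,
      forall P, finite_set [set Q | prime_ideal Q /\ f @^-1` Q = P] &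
      (forall P, maximal_ideal P -> X P ->
        exists2 Q, maximal_ideal Q & f @^-1` Q = P) /\
      (maximally_jacobson R -> forall Q, maximal_ideal Q ->
        maximal_ideal (f @^-1` Q))].

Lemma localized_stratifies (R : pzRingType) (P : set R) : right_noetherian R ->
  PI_ring R -> prime_ideal P -> exists c (B : pzRingType) (f : {rmorphism R -> B}),
    ~ P c /\ stratifies f [set P' | P `<=` P' /\ ~ P' c].
Proof.
move=> Rn RPI Pp; have [c [I [a [t [s dP]]]]] := prime_dual_basis_mod Rn RPI Pp.
have [Pc cC _ _ _] := dP; have [B [f [ci loc]]] := localization_exists Pp Pc cC.
exists c, B, f; split=> //; split.
- split; first exact: (localized_right_noetherian loc).
  have [lam d] := localized_central_dual_basis loc dP.
  by exists I, (f \o a), (f \o t), lam.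
- by move=> Q Qp; have [] := localized_preimage_prime loc Qp.
- move=> P' Pp' [PP' Pc'].
  have [Qp QP'] := localized_extension_prime loc Pp' PP' Pc'.
  by exists (localized_extension f ci P').
- move=> P'; have [[Q0 [[Qi0 _ _] Q0P']]|nQ] :=
    pselect (exists Q, prime_ideal Q /\ f @^-1` Q = P').
    apply: (sub_finite_set _ (finite_set1 Q0)) => Q [[Qi _ _] QP'] /=.
    by apply: (localized_preimage_inj loc) => //; rewrite QP' Q0P'.
  by apply: (sub_finite_set _ (finite_set0 _)) => Q HQ; apply: nQ; exists Q.
split.
- move=> P' Pm' [PP' Pc']; have [Pi' P1' Pm] := Pm'.
  have [[Qi Q1 _] QP'] := localized_extension_prime loc (maximal_prime Pm') PP' Pc'.
  exists (localized_extension f ci P') => //; split=> // K Ki QK.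
  have [||KP|KT] := Pm (f @^-1` K); first exact: preimage_ideal.
  + by rewrite -QP' => x; apply: QK.
  + by left; apply: (localized_preimage_inj loc) => //; rewrite KP QP'.
  + right; apply: ideal1 => //; have : [set: R] 1 by [].
    by rewrite -KT /= rmorph1.
move=> Rj Q Qm; have [Qi Q1 Qmax] := Qm.
have [Pp' PP' Pc'] := localized_preimage_prime loc (maximal_prime Qm).
have [F [FM QF]] := Rj _ Pp'.
(* The contraction of [Q] avoids [c] and is an intersection of maximal ideals, so one of these, [M],
   avoids [c]. It extends to a prime of [B] over [Q], which is [Q] by maximality; hence [Q]
   contracts to [M]. *)
have [M [FM' Mc]] : exists M, F M /\ ~ M c.
  apply: contrapT => nM; apply: Pc'; rewrite QF => M FM'.
  by apply: contrapT => Mc; apply: nM; exists M.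
have QM : f @^-1` Q `<=` M by rewrite QF => x; apply.
have Mm : maximal_ideal M := FM _ FM'.
have [[Ei E1 _] EM] := localized_extension_prime loc (maximal_prime Mm)
  (subset_trans PP' QM) Mc.
have [|EQ|ET] := Qmax _ Ei; last by case: E1; rewrite ET.
- by apply: (localized_preimage_sub loc) => //; rewrite EM.
- by rewrite -EQ EM.
Qed.

(** * Products of stratifications *)

Section ProductRing.
Variables T1 T2 : pzRingType.

Let p1 : {rmorphism T1 * T2 -> T1} := fst.
Let p2 : {rmorphism T1 * T2 -> T2} := snd.
Let p1_surj x : exists u, p1 u = x. Proof. by exists (x, 0). Qed.
Let p2_surj x : exists u, p2 u = x. Proof. by exists (0, x). Qed.

(** As (1, 0) r (0, 1) = 0 for all r, a prime contains one of the two idempotents and is pulled back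
    from the complementary factor. *)
Lemma prime_pair Q : prime_ideal Q ->
  (exists2 Q1, prime_ideal Q1 & Q = p1 @^-1` Q1) \/
  (exists2 Q2, prime_ideal Q2 & Q = p2 @^-1` Q2).
Proof.
move=> Qp; have [Qi _ _] := Qp.
have [r|Q10|Q01] := @prime_ideal_elt _ Q (1, 0) (0, 1) Qp.
- rewrite (_ : _ * _ = 0); first exact: Qi.1.1.
  by apply: injective_projections; rewrite /= ?mulr0 ?mul0r.
- have k2 u : p2 u = 0 -> Q u.
    case: u => x y /= ->; rewrite (_ : (x, 0) = (x, 0) * (1, 0)).
      exact: ideal_absorbl.
    by apply: injective_projections; rewrite /= ?mulr0 ?mulr1.
  right; exists (p2 @` Q); first exact: image_prime.
  by rewrite preimage_image //; exact: Qi.1.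
- have k1 u : p1 u = 0 -> Q u.
    case: u => x y /= ->; rewrite (_ : (0, y) = (0, y) * (0, 1)).
      exact: ideal_absorbl.
    by apply: injective_projections; rewrite /= ?mulr0 ?mulr1.
  left; exists (p1 @` Q); first exact: image_prime.
  by rewrite preimage_image //; exact: Qi.1.
Qed.

Lemma maximal_pair Q : maximal_ideal Q ->
  (exists2 Q1, maximal_ideal Q1 & Q = p1 @^-1` Q1) \/
  (exists2 Q2, maximal_ideal Q2 & Q = p2 @^-1` Q2).
Proof.
move=> Qm; have [[Q1 Qp1 QE]|[Q2 Qp2 QE]] := prime_pair (maximal_prime Qm).
  left; have k1 u : p1 u = 0 -> Q u.
    by move=> u0; rewrite QE /= u0; have [Qi _ _] := Qp1; apply: Qi.1.1.
  have [Qi _ _] := Qm; exists (p1 @` Q); first exact: image_maximal.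
  by rewrite preimage_image //; exact: Qi.1.
right; have k2 u : p2 u = 0 -> Q u.
  by move=> u0; rewrite QE /= u0; have [Qi _ _] := Qp2; apply: Qi.1.1.
have [Qi _ _] := Qm; exists (p2 @` Q); first exact: image_maximal.
by rewrite preimage_image //; exact: Qi.1.
Qed.

Lemma pair_right_noetherian : right_noetherian T1 -> right_noetherian T2 ->
  right_noetherian (T1 * T2)%type.
Proof.
move=> n1 n2 J Jr Jc.
have [||m1 m1P] := n1 (fun n => [set x | J n (x, 0)]).
- move=> n; have [[J0 JB] JM] := Jr n; split; first split=> //.
  + move=> x y /= Jx Jy; have := JB _ _ Jx Jy; congr (J n).
    by apply: injective_projections; rewrite /= ?subr0.
  + move=> x r /= Jx; have := JM _ (r, 0) Jx; congr (J n).
    by apply: injective_projections; rewrite /= ?mulr0.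
- by move=> n x; apply: Jc.
have [||m2 m2P] := n2 (fun n => [set y | J n (0, y)]).
- move=> n; have [[J0 JB] JM] := Jr n; split; first split=> //.
  + move=> x y /= Jx Jy; have := JB _ _ Jx Jy; congr (J n).
    by apply: injective_projections; rewrite /= ?subr0.
  + move=> x r /= Jx; have := JM _ (0, r) Jx; congr (J n).
    by apply: injective_projections; rewrite /= ?mulr0.
- by move=> n x; apply: Jc.
have JE n u : J n u <-> J n (u.1, 0) /\ J n (0, u.2).
  have [[J0 JB] JM] := Jr n; split=> [Ju|[Ju1 Ju2]].
    split; [have := JM _ (1, 0) Ju | have := JM _ (0, 1) Ju]; congr (J n);
      by apply: injective_projections; rewrite /= ?mulr0 ?mulr1.
  have := subgroupD (conj J0 JB) Ju1 Ju2; congr (J n).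
  by apply: injective_projections; rewrite /= ?addr0 ?add0r.
exists (maxn m1 m2) => m; rewrite geq_max => /andP[le1 le2].
apply/seteqP; split=> u /JE[Ju1 Ju2]; apply/JE.
  split.
  - have : [set x | J (maxn m1 m2) (x, 0)] u.1; last by [].
    by rewrite m1P ?leq_maxl // -(m1P m).
  - have : [set y | J (maxn m1 m2) (0, y)] u.2; last by [].
    by rewrite m2P ?leq_maxr // -(m2P m).
split.
- have : [set x | J m (x, 0)] u.1; last by [].
  by rewrite m1P // -(m1P (maxn m1 m2)) ?leq_maxl.
- have : [set y | J m (0, y)] u.2; last by [].
  by rewrite m2P // -(m2P (maxn m1 m2)) ?leq_maxr.
Qed.

Lemma pair_central_dual_basis (K1 K2 : finType) a1 t1 lam1 a2 t2 lam2 :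
  @central_dual_basis T1 1 K1 a1 t1 lam1 ->
  @central_dual_basis T2 1 K2 a2 t2 lam2 ->
  exists K a t lam, @central_dual_basis (T1 * T2)%type 1 K a t lam.
Proof.
move=> [lo1 lC1 lE1 lt1] [lo2 lC2 lE2 lt2].
pose i1 (x : T1) : T1 * T2 := (x, 0); pose i2 (y : T2) : T1 * T2 := (0, y).
pose lam (k : K1 + K2) u := match k with
  | inl k => i1 (lam1 k u.1) | inr k => i2 (lam2 k u.2) end.
have fst_sum (I : Type) (r : seq I) (F : I -> T1 * T2) :
  (\sum_(i <- r) F i).1 = \sum_(i <- r) (F i).1 by exact: (raddf_sum p1).
have snd_sum (I : Type) (r : seq I) (F : I -> T1 * T2) :
  (\sum_(i <- r) F i).2 = \sum_(i <- r) (F i).2 by exact: (raddf_sum p2).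
exists (K1 + K2)%type.
exists (fun k => match k with inl k => i1 (a1 k) | inr k => i2 (a2 k) end).
exists (fun k => match k with inl k => i1 (t1 k) | inr k => i2 (t2 k) end), lam.
split.
- move=> [k|k] /=.
    have [s sE] := lo1 k; exists [seq (i1 p.1, i1 p.2) | p <- s].
    apply/funext=> u; rewrite /lam sE /mulop big_map.
    apply: injective_projections; rewrite ?fst_sum ?snd_sum //=.
    by rewrite big1 // => p _; rewrite mulr0.
  have [s sE] := lo2 k; exists [seq (i2 p.1, i2 p.2) | p <- s].
  apply/funext=> u; rewrite /lam sE /mulop big_map.
  apply: injective_projections; rewrite ?fst_sum ?snd_sum //=.
  by rewrite big1 // => p _; rewrite mulr0.
- by move=> [k|k] u r; apply: injective_projections;
    rewrite /= ?mulr0 ?mul0r ?lC1 ?lC2.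
- move=> u; rewrite big_sumType /= mul1r.
  apply: injective_projections; rewrite /= !(fst_sum, snd_sum) /=.
    rewrite -[RHS]mul1r -lE1 [X in _ + X]big1 ?addr0 // => k _.
    by rewrite mulr0.
  rewrite -[RHS]mul1r -lE2 [X in X + _]big1 ?add0r // => k _.
  by rewrite mulr0.
rewrite big_sumType /=.
apply: injective_projections; rewrite /= !(fst_sum, snd_sum) /=.
  by rewrite lt1 big1 ?addr0.
by rewrite lt2 big1 ?add0r.
Qed.

Variables (R : pzRingType) (f1 : {rmorphism R -> T1}) (f2 : {rmorphism R -> T2}).

Definition pair_morph (x : R) : T1 * T2 := (f1 x, f2 x).
Fact pair_morph_zmod : zmod_morphism pair_morph.
Proof.
by move=> x y; apply: injective_projections; rewrite /= rmorphB.
Qed.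
Fact pair_morph_monoid : monoid_morphism pair_morph.
Proof.
by split=> [|x y]; apply: injective_projections;
  rewrite /= ?rmorph1 ?rmorphM.
Qed.
HB.instance Definition _ := GRing.isZmodMorphism.Build R (T1 * T2)%type
  pair_morph pair_morph_zmod.
HB.instance Definition _ := GRing.isMonoidMorphism.Build R (T1 * T2)%type
  pair_morph pair_morph_monoid.

(** [X1] and [X2] may overlap: a fibre is the union of the fibres over the two factors, whence
    finiteness in place of injectivity. *)
Lemma stratifies_pair X1 X2 X : stratifies f1 X1 -> stratifies f2 X2 ->
  (forall P, prime_ideal P -> X P <-> X1 P \/ X2 P) -> stratifies pair_morph X.
Proof.
move=> [[n1 [K1 [a1 [t1 [l1 d1]]]]] s1 h1 fin1 [m1 j1]].
move=> [[n2 [K2 [a2 [t2 [l2 d2]]]]] s2 h2 fin2 [m2 j2]] XE; split.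
- split; first exact: pair_right_noetherian.
  exact: pair_central_dual_basis d1 d2.
- move=> Q /prime_pair[[Q1 Qp1 ->]|[Q2 Qp2 ->]].
    by have [Pp XP] := s1 _ Qp1; split=> //; apply/XE => //; left.
  by have [Pp XP] := s2 _ Qp2; split=> //; apply/XE => //; right.
- move=> P Pp /(XE _ Pp)[/(h1 _ Pp)|/(h2 _ Pp)] [Q Qp QP].
    by exists (p1 @^-1` Q) => //; apply: preimage_prime.
  by exists (p2 @^-1` Q) => //; apply: preimage_prime.
- move=> P; have fU := finite_image (fun Q => p1 @^-1` Q) (fin1 P).
  have fV := finite_image (fun Q => p2 @^-1` Q) (fin2 P).
  have : finite_set ((fun Q => p1 @^-1` Q) @` [set Q | prime_ideal Q /\ f1 @^-1` Q = P]
    `|` (fun Q => p2 @^-1` Q) @` [set Q | prime_ideal Q /\ f2 @^-1` Q = P]).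
    by rewrite finite_setU.
  apply: sub_finite_set => Q [/prime_pair[[Q1 Qp1 ->]|[Q2 Qp2 ->]] QP].
    by left; exists Q1.
  by right; exists Q2.
split.
- move=> P Pm /(XE _ (maximal_prime Pm))[/(m1 _ Pm)|/(m2 _ Pm)] [Q Qm QP].
    by exists (p1 @^-1` Q) => //; apply: preimage_maximal.
  by exists (p2 @^-1` Q) => //; apply: preimage_maximal.
move=> Rj Q /maximal_pair[[Q1 Qm1 ->]|[Q2 Qm2 ->]]; first exact: j1.
exact: j2.
Qed.

End ProductRing.

(** * Noetherian induction *)

Lemma right_noetherian_maximal (R : pzRingType) (C : set (set R)) I0 :
  right_noetherian R -> (forall I, C I -> right_ideal I) -> C I0 ->
  exists2 I, C I & forall J, C J -> I `<=` J -> J = I.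
Proof.
move=> Rn Cr CI0; apply: contrapT => nI.
have /choice[nxt nxtP] : forall I, exists J, C I -> [/\ C J, I `<=` J & J <> I].
  move=> I; have [CI|] := pselect (C I); last by exists I.
  apply: contrapT => nJ; apply: nI; exists I => // J CJ IJ.
  by apply: contrapT => JI; apply: nJ; exists J.
pose D n := iter n nxt I0.
have CD n : C (D n) by elim: n => //= n /nxtP[].
have [||n nP] := Rn D; first by move=> n; apply: Cr.
- by move=> n; have [] := nxtP _ (CD n).
by have [_ _] := nxtP _ (CD n); apply; apply: (nP n.+1).
Qed.

Lemma ideal_right_ideal (R : pzRingType) (I : set R) : ideal I -> right_ideal I.
Proof. by move=> [Ig IM]; split=> // x r /(IM _ r)[]. Qed.

Lemma ideal_noetherian_ind (R : pzRingType) (Pr : set R -> Prop) :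
  right_noetherian R ->
  (forall I, ideal I ->
    (forall J, ideal J -> I `<=` J -> J <> I -> Pr J) -> Pr I) ->
  forall I, ideal I -> Pr I.
Proof.
move=> Rn IH I0 Ii0; apply: contrapT => nI0.
have [||I [Ii nI] Imax] := @right_noetherian_maximal R
  [set I | ideal I /\ ~ Pr I] I0 Rn; first by move=> I [/ideal_right_ideal].
  by [].
apply: nI; apply: IH => // J Ji IJ JI; apply: contrapT => nJ.
by apply: JI; apply: Imax.
Qed.

Lemma stratification_exists (R : pzRingType) : right_noetherian R -> PI_ring R ->
  forall I : set R, ideal I ->
  exists (T : pzRingType) (f : {rmorphism R -> T}), stratifies f [set P | I `<=` P].
Proof.
move=> Rn RPI; apply: ideal_noetherian_ind => // I Ii IH.
(* No prime contains the unit ideal; the zero ring serves, with an empty dual basis. *)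
have [I1|I1] := pselect (I 1).
  pose f : {rmorphism R -> quot_ring (@ideal_setT R)} :=
    @quot_ring_proj R setT (@ideal_setT R).
  have fs : forall s, exists r, f r = s by exact: quot_ring_proj_surj.
  have T0 (u : quot_ring (@ideal_setT R)) : u = 0.
    by have [x <-] := fs u; apply/quot_ring_proj0.
  have Q0 (Q : set (quot_ring (@ideal_setT R))) : ideal Q -> ~ Q 1 -> False.
    by move=> Qi; apply; rewrite (T0 1); apply: Qi.1.1.
  have P0 (P : set R) : ~ P 1 -> I `<=` P -> False by move=> P1 /(_ _ I1).
  exists (quot_ring (@ideal_setT R)), f; split.
  - split; first exact: image_right_noetherian.
    exists void, (fun=> 0), (fun=> 0), (fun _ _ => 0); split=> [[]|[]|x|].
      by rewrite [LHS]T0 [RHS]T0.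
    by rewrite [LHS]T0 [RHS]T0.
  - by move=> Q [Qi Q1 _]; case: (Q0 _ Qi Q1).
  - by move=> P [_ P1 _] /(P0 _ P1).
  - move=> P; apply: (sub_finite_set _ (finite_set0 _)) => Q [[Qi Q1 _] _].
    by case: (Q0 _ Qi Q1).
  split; first by move=> P [_ P1 _] /(P0 _ P1).
  by move=> _ Q [Qi Q1 _]; case: (Q0 _ Qi Q1).
have [Ip|nIp] := pselect (prime_ideal I).
  have [c [B [f [Ic fB]]]] := localized_stratifies Rn RPI Ip.
  pose g := smallest (@ideal R) [set c].
  have gi : ideal g by exact: smallest_ideal.
  have gc : g c by move=> J [_]; apply.
  pose J := [set x + y | x in I & y in g].
  have Ji : ideal J by exact: ideal_addP.
  have IJ : I `<=` J by move=> x Ix; exists x => //; exists 0; rewrite ?addr0 //; exact: gi.1.1.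
  have gJ : g `<=` J by move=> x gx; exists 0; [exact: Ii.1.1|exists x; rewrite ?add0r].
  have [|T [h hT]] := IH J Ji IJ.
    by move=> JI; apply: Ic; rewrite -JI; apply: gJ.
  exists (B * T)%type, (pair_morph f h); apply: (stratifies_pair fB hT) => P [Pi _ _] /=.
  split=> [IP|[[]//|JP]]; last by move=> x /IJ/JP.
  have [Pc|] := pselect (P c); [right|by left].
  move=> _ [x Ix [y gy <-]]; apply: subgroupD Pi.1 _ _; first exact: IP.
  by apply: gy; split=> // _ ->.
(* If [I] is not prime, it contains a product of two ideals [J] and [K] that it does not contain.
   The primes over [I] are then those over I + J or I + K, both strictly larger than [I]. *)
have [J [K [Ji Ki JK [JI KI]]]] : exists J K, [/\ ideal J, ideal K,
    ideal_mul J K `<=` I & ~ J `<=` I /\ ~ K `<=` I].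
  apply: contrapT => nJK; apply: nIp; split=> // J K Ji Ki JK.
  apply: contrapT => /not_orP[JI KI]; apply: nJK; exists J, K; split=> //.
have key (L : set R) : ideal L -> ~ L `<=` I -> exists (T : pzRingType)
    (f : {rmorphism R -> T}), stratifies f [set P | [set x + y | x in I & y in L] `<=` P].
  move=> Li LI; have IL : I `<=` [set x + y | x in I & y in L].
    by move=> x Ix; exists x => //; exists 0; rewrite ?addr0 //; exact: Li.1.1.
  apply: IH => //; first exact: ideal_addP.
  move=> E; apply: LI => x Lx; rewrite -E; exists 0; first exact: Ii.1.1.
  by exists x; rewrite ?add0r.
have [T1 [f1 st1]] := key J Ji JI; have [T2 [f2 st2]] := key K Ki KI.
exists (T1 * T2)%type, (pair_morph f1 f2).
apply: (stratifies_pair st1 st2) => P [Pi _ Pp] /=; split=> [IP|[]JP x Ix].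
- have sub L : L `<=` P -> [set x + y | x in I & y in L] `<=` P.
    by move=> LP _ [x Ix [y Ly <-]]; apply: subgroupD Pi.1 _ _; [exact: IP|exact: LP].
  by have [|JP|KP] := Pp J K Ji Ki; [exact: subset_trans JK IP|left; apply: sub|right; apply: sub].
- by apply: JP; exists x => //; exists 0; rewrite ?addr0 //; exact: Ji.1.1.
- by apply: JP; exists x => //; exists 0; rewrite ?addr0 //; exact: Ki.1.1.
Qed.

(** * Primitive ideals and the fibres of theta *)

Section ModuleAction.
Variables (R : pzRingType) (M : lmodType R^c).
Implicit Types (m : M) (r s : R).

Definition act m r : M := (r : R^c) *: m.

Lemma actM m r s : act (act m r) s = act m (r * s).
Proof. by rewrite /act scalerA. Qed.
Lemma act1 m : act m 1 = m. Proof. exact: scale1r. Qed.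
Lemma act0 m : act m 0 = 0. Proof. exact: scale0r. Qed.
Lemma actBr m r s : act m (r - s) = act m r - act m s.
Proof. exact: scalerBl. Qed.
Lemma actDr m r s : act m (r + s) = act m r + act m s.
Proof. exact: scalerDl. Qed.
Lemma actDl m m' r : act (m + m') r = act m r + act m' r.
Proof. exact: scalerDr. Qed.
Lemma actBl m m' r : act (m - m') r = act m r - act m' r.
Proof. exact: scalerBr. Qed.
Lemma act0l r : act 0 r = 0. Proof. exact: scaler0. Qed.
Lemma act_sum m (I : Type) (l : seq I) F :
  act m (\sum_(i <- l) F i) = \sum_(i <- l) act m (F i).
Proof. exact: scaler_suml. Qed.

Notation P := (ann_along (@id R) M).

Lemma ann_ideal : ideal P.
Proof.
split; [split|] => [m|r s Pr Ps m|r s Pr].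
- exact: act0.
- by rewrite -/(act m (r - s)) actBr /act Pr Ps subrr.
split=> m.
  by rewrite -/(act m (s * r)) -actM /act Pr.
by rewrite -/(act m (r * s)) -actM {2}/act Pr act0l.
Qed.

Hypothesis Msimple : simple_module M.

Lemma simple_cyclic m : m != 0 -> forall m', exists r, m' = act m r.
Proof.
move=> m0 m'; have [_ /(_ [set m' | exists r, m' = act m r])[]] := Msimple.
- split; [split|] => [|_ _ [r ->] [s ->]|a _ [r ->]].
  + by exists 0; rewrite act0.
  + by exists (r - s); rewrite actBr.
  + by exists (r * a); rewrite -actM.
- move=> E; have : [set m' | exists r, m' = act m r] m by exists 1; rewrite act1.
  by rewrite E /= => /eqP; rewrite (negbTE m0).
- by move=> E; have : [set: M] m' by []; rewrite -E.
Qed.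

Lemma simple_ann_prime : prime_ideal P.
Proof.
have [[m0 m00] _] := Msimple; apply: prime_ideal_of_elt => //; first exact: ann_ideal.
  by move=> P1; apply: m00; rewrite -[m0]act1; apply: P1.
move=> x y xy; apply: contrapT => /not_orP[/existsNP[m /eqP mx]] /existsNP[m' m'y].
apply: m'y; have [r ->] := simple_cyclic mx m'.
have : act m (x * r * y) = 0 by exact: xy.
by rewrite -!actM.
Qed.

(** Centrality modulo the annihilator [P]; such a [y] acts on [M] by a module endomorphism. *)
Let cm y := forall r, P (r * y - y * r).

Let cm_act y : cm y -> forall m r, act m (r * y) = act m (y * r).
Proof.
by move=> cy m r; apply/eqP; rewrite -subr_eq0 -actBr; apply/eqP/cy.
Qed.

Let cmP y : (forall m r, act m (r * y) = act m (y * r)) -> cm y.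
Proof. by move=> H r m; rewrite -/(act m _) actBr H subrr. Qed.

Let cm1 : cm 1. Proof. by apply: cmP => m r; rewrite mul1r mulr1. Qed.

Let cmB y z : cm y -> cm z -> cm (y - z).
Proof.
move=> cy cz; apply: cmP => m r.
by rewrite mulrBr mulrBl !actBr (cm_act cy) (cm_act cz).
Qed.

Let cmD y z : cm y -> cm z -> cm (y + z).
Proof.
move=> cy cz; apply: cmP => m r.
by rewrite mulrDr mulrDl !actDr (cm_act cy) (cm_act cz).
Qed.

Let cmM y z : cm y -> cm z -> cm (y * z).
Proof.
move=> cy cz; apply: cmP => m r.
rewrite mulrA (cm_act cz) -actM (cm_act cy) actM mulrA.
by rewrite -actM (cm_act cy) actM.
Qed.

Fixpoint central_span (l : seq M) : set M :=
  if l is e :: l' then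
    [set m | exists y m', [/\ cm y, central_span l' m' & m = act e y + m']]
  else [set 0].

Lemma central_span_add l m m' :
  central_span l m -> central_span l m' -> central_span l (m + m').
Proof.
elim: l m m' => [|e l IH] m m' /=; first by move=> -> ->; rewrite addr0.
move=> [y [n [cy ln ->]]] [y' [n' [cy' ln' ->]]]; exists (y + y'), (n + n').
by split; [exact: cmD | exact: IH | rewrite actDr addrACA].
Qed.

Lemma central_span_act l m z : cm z -> central_span l m -> central_span l (act m z).
Proof.
move=> cz; elim: l m => [|e l IH] m /=; first by move=> ->; rewrite act0l.
move=> [y [n [cy ln ->]]]; exists (y * z), (act n z).
by split; [exact: cmM | exact: IH | rewrite actDl actM].
Qed.

Lemma central_span_sum (I : eqType) (l : seq I) (e : I -> M) y :
  (forall i, cm (y i)) ->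
  central_span [seq e i | i <- l] (\sum_(i <- l) act (e i) (y i)).
Proof.
move=> cy; elim: l => [|i l IH] /=; first by rewrite big_nil.
by exists (y i), (\sum_(i <- l) act (e i) (y i)); rewrite big_cons.
Qed.

(* Nakayama's lemma for the submodules [M s], eliminating one generator of [M]
   over the center of [R / P] at a time. *)
Lemma central_span_nakayama (J : set R) z l s : ideal J -> P `<=` J -> J z -> cm z ->
  (forall m, exists m', m = act m' z) ->
  cm s -> J (1 - s) -> (forall m, central_span l (act m s)) -> J 1.
Proof.
move=> Ji PJ Jz cz Mz; elim: l s => [|e l IH] s cs Js ls.
  rewrite -[1](subrK s); apply: subgroupD Ji.1 _ _ => //.
  by apply: PJ => m; apply: ls.
have [m1 em1] := Mz e; have [y [n [cy ln nE]]] := ls m1.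
have cyz : cm (y * z) by exact: cmM.
have ct : cm (s - y * z) by exact: cmB.
(* From e = m1 z and m1 s = e y + n one gets e s = e y z + n z, so [s - y * z] moves [e] into the
   span of the remaining generators. The product with [s] treats all of [M] and is still 1 modulo
   [J]. *)
apply: (IH (s * (s - y * z))); first exact: cmM.
  have -> : 1 - s * (s - y * z) = (1 - s) + s * (1 - s) + s * y * z.
    rewrite !mulrBr mulr1 opprB [1 - s + _]addrA subrK -addrA.
    by congr (_ + _); rewrite addrC mulrA.
  apply: subgroupD Ji.1 _ _; last exact: ideal_absorbl.
  by apply: subgroupD Ji.1 _ _ => //; exact: ideal_absorbl.
have et : central_span l (act e (s - y * z)).
  suff -> : act e (s - y * z) = act n z by exact: central_span_act.
  have es : act e s = act e (y * z) + act n z.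
    by rewrite {1}em1 actM (cm_act cs) -actM nE actDl actM.
  by rewrite actBr es addrAC subrr add0r.
move=> m; rewrite -actM; have [y'' [n'' [cy'' ln'' ->]]] := ls m.
rewrite actDl actM (cm_act ct) -actM.
by apply: central_span_add; apply: central_span_act.
Qed.

(** If [J] contains [P] and some [j] outside [P], one coordinate z of [j] is outside [P]; it lies in
    [J], is central modulo [P], and M z = M by simplicity. Since M c = M as well, m = m0 r c, and
    the expansion of c r writes m through the m0 a_i with central coefficients. Nakayama then puts 1
    in [J]. *)
Lemma simple_ann_maximal c (I : finType) a t (s : I -> seq (R * R)) :
  @dual_basis_mod R P c I a t s -> maximal_ideal P.
Proof.
move=> [Pc cC lC lE _]; have Pp := simple_ann_prime; have [Pi P1 _] := Pp.
have [[m0 /eqP m00] Mmax] := Msimple.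
have divisible z : cm z -> ~ P z -> forall m, exists m', m = act m' z.
  move=> cz /existsNP[m mz] m'; have [] := Mmax [set m | exists m', m = act m' z].
  - split; [split|] => [|_ _ [n ->] [n' ->]|r _ [n ->]].
    + by exists 0; rewrite act0l.
    + by exists (n - n'); rewrite actBl.
    + by exists (act n r); rewrite -/(act _ r) !actM (cm_act cz).
  - move=> E; case: mz; have : [set m | exists m', m = act m' z] (act m z) by exists m.
    by rewrite E.
  - by move=> E; have : [set: M] m' by []; rewrite -E.
split=> // J Ji PJ; have [JP|/existsNP[j /not_implyP[Jj Pj]]] := pselect (J `<=` P).
  by left; apply/seteqP.
right; apply: ideal1 => //.
have [i Pz] : exists i, ~ P (mulop (s i) j).
  apply: contrapT => nP.
  have Pcj : P (c * j).
    rewrite -[c * j](subrK (\sum_i mulop (s i) j * a i)).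
    apply: subgroupD Pi.1 _ _; last first.
      apply: (ideal_sum Pi) => i; apply: (ideal_absorbr _ Pi).
      by apply: contrapT => Pij; apply: nP; exists i.
    by rewrite -opprB; exact: (subgroupN Pi.1 (lE j)).
  have [r||] := @prime_ideal_elt _ P c j Pp; [|exact: Pc|exact: Pj].
  rewrite -[c * r](subrK (r * c)) mulrDl -mulrA; apply: subgroupD Pi.1 _ _.
    by apply: (ideal_absorbr _ Pi); rewrite -opprB; exact: (subgroupN Pi.1 (cC r)).
  exact: (ideal_absorbl _ Pi).
have cz : cm (mulop (s i) j) by move=> r; apply: lC.
have Jz : J (mulop (s i) j) by apply: ideal_mulop => //; exists (s i).
apply: (central_span_nakayama (l := [seq act m0 (a i) | i <- index_enum I]) Ji PJ
  Jz cz (divisible _ cz Pz) cm1).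
  by rewrite subrr; exact: Ji.1.1.
move=> m; rewrite act1; have [m1 ->] := divisible c cC Pc m.
have [r ->] := simple_cyclic m00 m1.
rewrite actM (cm_act cC) -[c * r](subrK (\sum_i mulop (s i) r * a i)) actDr.
rewrite -opprB -[- _]mulN1r -actM.
have -> : act (act m0 (-1)) (\sum_i mulop (s i) r * a i - c * r) = 0 by exact: lE.
rewrite add0r act_sum; under eq_bigr => k _.
  rewrite -(cm_act (y := mulop (s k) r)); last by move=> u; apply: lC.
  rewrite -actM; over.
by apply: central_span_sum => k u; apply: lC.
Qed.

End ModuleAction.

Lemma Prim_sub_Max (R : pzRingType) : right_noetherian R -> PI_ring R ->
  Prim R `<=` Max R.
Proof.
move=> Rn RPI _ [M [Ms ->]].
have [c [I [a [t [s]]]]] := prime_dual_basis_mod Rn RPI (simple_ann_prime Ms).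
exact: simple_ann_maximal.
Qed.

(** Let [N] be maximal among the proper right ideals over [P]. Then R/N is simple, and its
    annihilator is a proper ideal containing [P], hence [P]. *)
Lemma Max_sub_Prim (R : pzRingType) : right_noetherian R -> Max R `<=` Prim R.
Proof.
move=> Rn P [Pi P1 Pm].
have [||N [[Ng NM] N1 PN] Nmax] := @right_noetherian_maximal R
  [set N | [/\ right_ideal N, ~ N 1 & P `<=` N]] P Rn.
- by move=> N [].
- by split=> //; exact: ideal_right_ideal.
have Nsub : @submodule R^c (R^c)^o N.
  by split=> // r x Nx; apply: NM.
pose M : lmodType R^c := quot_module Nsub.
pose pr : R -> M := @quot_proj (R^c)^o N Nsub.1.
have prE x y : pr x = pr y <-> N (x - y) by exact: (@quot_proj_eq (R^c)^o N Nsub.1).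
have pr0 x : pr x = 0 <-> N x.
  have -> : (0 : M) = pr 0 by rewrite /pr; exact: (esym (raddf0 (@quot_proj (R^c)^o N Nsub.1))).
  by rewrite prE subr0.
have prZ (r x : R) : (r : R^c) *: pr x = pr (x * r).
  exact: (@quot_scaleE R^c (R^c)^o N Nsub r x).
have prB x y : pr (x - y) = pr x - pr y.
  exact: (raddfB (@quot_proj (R^c)^o N Nsub.1)).
have prs u : exists x, pr x = u by exact: (@quot_proj_surj (R^c)^o N Nsub.1 u).
exists M; split; first split.
- by exists (pr 1) => /pr0.
- move=> K [[K0 KB] KZ]; pose L := [set x | K (pr x)].
  have NL : N `<=` L by move=> x /pr0 xN; rewrite /L /= xN.
  have Lr : right_ideal L.
    split; first split; rewrite /L.
    + by apply: NL; exact: Ng.1.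
    + by move=> x y /= Kx Ky; rewrite prB; apply: KB.
    + by move=> x r /= Kx; rewrite -prZ; apply: KZ.
  have [L1|L1] := pselect (L 1).
    right; apply/seteqP; split=> // u _; have [x <-] := prs u.
    by rewrite -[x]mul1r -prZ; apply: KZ.
  left; have LN : L = N by apply: Nmax => //; split=> //; exact: subset_trans NL.
  apply/seteqP; split=> u; last by move=> ->.
  by have [x <-] := prs u => Kx; apply/pr0; rewrite -LN.
have [||AP|AT] := Pm (ann_along (@id R) M); first exact: ann_ideal.
- move=> x Px u; have [y <-] := prs u; rewrite prZ; apply/pr0/PN.
  exact: ideal_absorbl.
- by rewrite AP.
- have : [set: R] 1 by []; rewrite -AT => /(_ (pr 1)).
  by rewrite prZ mulr1 => /pr0.
Qed.

(** * The annihilator of the base change of Z/q to T is qT *)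

Section AnnihilatorOfBaseChange.
Variables (T : pzRingType) (q : spec (center T)).
Notation A := (residue_module q).
Notation E := (extension (spec_ideal q)).

Let qi : ideal (spec_ideal q). Proof. by have [] := spec_prime q. Qed.
Let pr : center T -> A := quot_proj (spec_submodule q).1.
Let prE x y : pr x = pr y <-> spec_ideal q (x - y). Proof. exact: quot_proj_eq. Qed.
Let prs u : exists x, pr x = u. Proof. exact: quot_proj_surj. Qed.
Let prK (u : A) : pr (repr u) = u. Proof. by rewrite /pr /quot_proj reprK. Qed.

Let tens_extension (a : A) (x : center_module T) : E x -> tens a x = 0.
Proof.
have t0 (b : center_module T) : tens (0 : A) b = 0.
  by apply: (addrI (tens (0 : A) b)); rewrite -tensDl !addr0.
have tr0 (b : A) : tens b (0 : center_module T) = 0.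
  by apply: (addrI (tens b (0 : center_module T))); rewrite -tensDr !addr0.
move=> Ex; move: a; pose G : set T := [set x | forall a : A, tens a (x : center_module T) = 0].
apply: (extension_min (G := G)) Ex.
  split; first by move=> a; apply: tr0.
  move=> u v Gu Gv a; have := tensDr a (u - v : center_module T) (v : center_module T).
  by rewrite subrK Gu Gv addr0.
move=> z b qz a; have [y <-] := prs a.
rewrite -[X in tens _ X]/((z : center T) *: (b : center_module T)) -tensZ.
suff -> : z *: pr y = 0 by apply: t0.
have -> : z *: pr y = pr (z * y) by exact: quot_scaleE.
have -> : (0 : A) = pr 0 by exact: (esym (raddf0 (quot_proj (spec_submodule q).1))).
by apply/prE; rewrite subr0; apply: ideal_absorbr.
Qed.

Lemma ann_base_change (t : T) :
  (forall m : base_change A, (t : T^c) *: m = 0) <-> E t.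
Proof.
have Ei := extension_ideal (spec_ideal q).
split=> [t0|Et]; last first.
  suff t0 u : base_change_scale (A := A) (t : T^c) u = 0 by exact: t0.
  elim/tensor_ind: u => [|u v IHu IHv|a b]; first by rewrite raddf0.
    by rewrite raddfB /= IHu IHv subrr.
  by rewrite base_change_scale_tens; apply: tens_extension; exact: (ideal_absorbl _ Ei).
(* The multiplication map to T/qT, which sends the tensor of 1 and t to the class of t; thus t dies
   there if it annihilates the tensor product. By [hE] the representative picked by [repr] is
   immaterial. *)
pose h (a : A) (b : center_module T) : quot_ring Ei :=
  quot_ring_proj Ei (center_val (repr a : center T) * (b : T)).
have hE z (b : center_module T) : h (pr z) b = quot_ring_proj Ei (center_val z * (b : T)).
  apply/eqP; rewrite -subr_eq0 -rmorphB -mulrBl -center_valB; apply/eqP.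
  by apply/quot_ring_proj0; apply: mem_extension; apply/prE; rewrite prK.
have hDl a a' b : h (a + a') b = h a b + h a' b.
  have [x <-] := prs a; have [y <-] := prs a'.
  have -> : pr x + pr y = pr (x + y).
    exact: (esym (raddfD (quot_proj (spec_submodule q).1) x y)).
  by rewrite !hE center_valD mulrDl raddfD.
have hDr a b b' : h a (b + b') = h a b + h a b'.
  by rewrite /h mulrDr raddfD.
have hZ k a b : h (k *: a) b = h a (k *: b).
  have [x <-] := prs a; have -> : k *: pr x = pr (k * x) by exact: quot_scaleE.
  by rewrite !hE center_valM (center_valC k) mulrA.
have := t0 (tens (pr 1) ((1 : T) : center_module T)).
rewrite -[LHS]/(base_change_scale (A := A) (t : T^c) (tens (pr 1) ((1 : T) : center_module T))).
rewrite base_change_scale_tens mul1r => /(congr1 (tensor_lift h)).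
rewrite tensor_lift_tens // hE center_val1 mul1r => ht.
apply/(quot_ring_proj0 Ei); rewrite ht.
have := tensor_lift_is_zmod_morphism hDl hDr hZ 0 0; rewrite !subrr.
by [].
Qed.

End AnnihilatorOfBaseChange.

(** * The map from Spec Z to Spec R *)

Lemma spec_inj (R : pzRingType) : injective (@spec_ideal R).
Proof.
by move=> [P Pp] [Q Qp] /= PQ; case: _ / PQ in Qp *; rewrite (Prop_irrelevance Pp Qp).
Qed.

Theorem mainTheorem4 (R : pzRingType)
  (R_noeth : right_noetherian R) (R_PI : PI_ring R) :
  exists (T : pzRingType) (phi : {rmorphism R -> T}),
    [/\ right_noetherian T,
        ideally_commutative T,
        right_noetherian (center T) &
        exists theta : spec (center T) -> spec R,
          [/\ forall q, theta q = ann_along phi (base_change (residue_module q)) :> set R,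
              continuous theta,
              forall P, finite_set (theta @^-1` [set P]),
              range theta = setT &
              jacobson R -> jacobson (center T) ->
                [set (theta q : set R) | q in [set q : spec (center T) | Max (center T) q]] = Prim R
                /\ Prim R = Max R]].
Proof.
have i0 : ideal [set (0 : R)].
  split; [split=> // _ _ -> ->; exact: subr0|move=> _ r ->].
  by rewrite mulr0 mul0r.
have zP (P : set R) : ideal P -> [set (0 : R)] `<=` P by move=> Pi _ ->; exact: Pi.1.1.
have [T [phi [[Tn [K [a [t [lam dT]]]]] sp hit fin [mhit mj]]]] :=
  stratification_exists R_noeth R_PI i0.
have Tic := central_dual_basis_ideally_commutative dT.
have [EC CE _ _] := Tic.
exists T, phi; split=> //; first exact: center_right_noetherian.
pose ext (q : spec (center T)) : set T := extension (spec_ideal q).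
have extp q : prime_ideal (ext q) by apply: extension_prime => //; exact: spec_prime.
have qE (q : spec (center T)) : contraction (ext q) = q.
  by apply: CE; have [] := spec_prime q.
(* By [ann_base_change] the required annihilator is the preimage of qT, so [theta] is the bijection
   from primes of Z to primes of T followed by contraction to [R]. *)
pose theta q : spec R := Spec (sp _ (extp q)).1.
have thetaE q : theta q = phi @^-1` (ext q) :> set R by [].
have lift (Q : set T) (Qp : prime_ideal Q) :
    ext (Spec (contraction_prime Tic Qp)) = Q by have [Qi _ _] := Qp; exact: EC.
exists theta; split.
- move=> q; apply/seteqP; split=> r /=.
    by move=> /(ann_base_change q (phi r)).2.
  by move=> /(ann_base_change q (phi r)).1.
- apply/continuous_closedP => C /closed_specP[S ->]; apply/closed_specP.
  exists (contraction (smallest (@ideal T) (phi @` S))).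
  have gi : ideal (smallest (@ideal T) (phi @` S)) by exact: smallest_ideal.
  apply/seteqP; split=> q /= Sq.
    rewrite /zariski_closed /= -(qE q) => z gz; apply: gz.
    by split; [have [] := extp q | move=> _ [x Sx <-]; exact: Sq].
  move=> x Sx; rewrite thetaE /=.
  have : smallest (@ideal T) (phi @` S) (phi x) by move=> J [_]; apply; exists x.
  by rewrite -(EC _ gi); apply: extensionS.
- move=> P; apply: (sub_finite_set (B := ext @^-1`
      [set Q | prime_ideal Q /\ phi @^-1` Q = P])).
    by move=> q /= <-; split.
  apply: finite_preimage => // q q' _ _ qq'.
  by apply: spec_inj; rewrite -(qE q) qq' qE.
- apply/seteqP; split=> // P _.
  have [Pi _ _] := spec_prime P; have [Q Qp QP] := hit _ (spec_prime P) (zP _ Pi).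
  exists (Spec (contraction_prime Tic Qp)) => //; apply: spec_inj.
  by rewrite thetaE lift.
move=> Rj _; have PM : Prim R = Max R.
  by apply/seteqP; split; [exact: Prim_sub_Max | exact: Max_sub_Prim].
have Rmj : maximally_jacobson R by rewrite /maximally_jacobson -PM.
split=> //; rewrite PM; apply/seteqP; split=> [_ [q qm <-]|P Pm].
  by rewrite thetaE; apply: mj => //; apply: extension_maximal.
have [Pi _ _] := Pm; have [Q Qm QP] := mhit _ Pm (zP _ Pi).
exists (Spec (contraction_prime Tic (maximal_prime Qm))).
  exact: contraction_maximal.
by rewrite thetaE lift.
Qed.
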